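(* Let $(V,m,b)$ be a weighted directed graph satisfying the standing assumptions (locally finite, weakly connected, $\sum_{y}b(x,y)>0$ for all $x$, and Kirchhoff's assumption). Suppose that the graph is $\chi$-complete for the symmetric conductance $b'(x,y)=\frac{b(x,y)+b(y,x)}{2}$, and that $$\exists C>0,\ \forall x\in V,\quad \frac{1}{m(x)}\sum_{y\in V_x}\frac{|b(x,y)-b(y,x)|^2}{b'(x,y)}\leq C .$$ Then the closure $\overline{\Delta}$ of the non-symmetric Laplacian $\Delta$ in $\ell^2(V,m)$ is m-accretive.
   Context: Graph: $V$ is a countable set, $b:V\times V\to[0,\infty)$ satisfies $b(x,x)=0$ for all $x$, the directed edges are $\vec E=\{(x,y): b(x,y)>0\}$, and $m:V\to(0,\infty)$ is a weight on vertices. For $x\in V$, $V_x=\{y\in V: b(x,y)>0\text{ or }b(y,x)>0\}$. Standing assumptions: (1) locally finite: every $V_x$ is finite; (2) weakly connected: any two vertices are joined by a finite chain of undirected edges $\{x,y\}$ (pairs with $b(x,y)>0$ or $b(y,x)>0$); (3) $\sum_{y\in V}b(x,y)>0$ for all $x\in V$; (4) Kirchhoff's assumption: $\sum_{y}b(x,y)=\sum_{y}b(y,x)$ for all $x\in V$. Function spaces: $\mathcal C_c(V)$ is the set of finitely supported functions $V\to\mathbb C$; $\ell^2(V,m)$ is the Hilbert space of $f:V\to\mathbb C$ with $\sum_x m(x)|f(x)|^2<\infty$, with scalar product $\langle f,g\rangle=\sum_x m(x)f(x)\overline{g(x)}$. Laplacian: $\Delta$ is the operator on $\ell^2(V,m)$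 with domain $\mathcal C_c(V)$, $\Delta f(x)=\frac{1}{m(x)}\sum_{y\in V}b(x,y)(f(x)-f(y))$. It is closable and $\overline{\Delta}$ is its closure. An operator $A$ with domain $D(A)$ is accretive if $\operatorname{Re}\langle Af,f\rangle\ge 0$ for all $f\in D(A)$. An accretive operator $A$ is m-accretive if the open left half-plane is contained in its resolvent set and $\|(A+\lambda)^{-1}\|\le \frac{1}{\operatorname{Re}\lambda}$ for all $\lambda$ with $\operatorname{Re}\lambda>0$. $\chi$-completeness for $b'$: there exist an increasing sequence of finite sets $(B_n)_{n\in\mathbb N}$ with $V=\bigcup_n B_n$ and functions $\chi_n$ such that (i) $\chi_n\in\mathcal C_c(V)$, $0\le\chi_n\le1$; (ii) $\chi_n(v)=1$ for $v\in B_n$; (iii) there is $C>0$ such that for all $n\in\mathbb N$, $x\in V$, $\frac{1}{m(x)}\sum_{y\in V_x}b'(x,y)|\chi_n(x)-\chi_n(y)|^2\le C$. *)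

(* Defs.v *)
From HB Require Import structures.
From mathcomp Require Import all_boot all_order all_algebra.
From mathcomp Require Import complex.
From mathcomp Require Import all_classical all_reals all_analysis.
From mathcomp Require Import ring.

Set Implicit Arguments.
Unset Strict Implicit.
Unset Printing Implicit Defensive.

Import Order.TTheory GRing.Theory Num.Theory.
Import numFieldNormedType.Exports.
Local Open Scope classical_set_scope.
Local Open Scope ring_scope.
Local Open Scope complex_scope.

Section directed_graph.
Context {R : realType} {V : countType}.
Implicit Types (b c : V -> V -> R) (m : V -> R).

Definition adjacent b : rel V := fun x y => (0 < b x y) || (0 < b y x).

(* V_x *)
Definition neighbours b (x : V) : set V := [set y | adjacent b x y].

Definition locally_finite b := forall x, finite_set (neighbours b x).

Definition weakly_connected b :=
  forall x y, exists2 s : seq V, path (adjacent b) x s & last x s = y.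

(* The finitely supported sums \sum_(y \in [set: V]) below are genuine sums
   over V as soon as [locally_finite b] holds and b is nonnegative. *)
Definition positive_outflow b := forall x, 0 < \sum_(y \in [set: V]) b x y.

Definition kirchhoff b :=
  forall x, \sum_(y \in [set: V]) b x y = \sum_(y \in [set: V]) b y x.

Definition symmetrized b : V -> V -> R := fun x y => (b x y + b y x) / 2.

(* C_c(V), for real- or complex-valued functions *)
Definition Cc {M : nmodType} : set (V -> M) :=
  [set f | finite_set [set x | f x != 0]].

(* chi-completeness of the graph (V, m, b) for the conductance c *)
Definition chi_complete b m c :=
  exists (B : nat -> set V) (chi : nat -> V -> R),
    [/\ [/\ forall n, finite_set (B n),
            forall n, B n `<=` B n.+1 &
            \bigcup_n B n = [set: V] ],
        forall n, Cc (chi n) /\ (forall x, 0 <= chi n x <= 1),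
        forall n x, B n x -> chi n x = 1 &
        exists2 C : R, 0 < C & forall n x,
          (m x)^-1 *
            \sum_(y \in neighbours b x) (c x y * `|chi n x - chi n y| ^+ 2)
          <= C].

Definition bounded_asymmetry b m :=
  exists2 C : R, 0 < C & forall x,
    (m x)^-1 * \sum_(y \in neighbours b x)
                 (`|b x y - b y x| ^+ 2 / symmetrized b x y) <= C.

End directed_graph.

Section absolutely_convergent_sums.
Context {R : realType} {V : choiceType}.

(* Sum of an absolutely summable real family, resp. complex family, taken as
   the difference of the sums of the positive and negative parts. *)
Definition rsum (F : V -> R) : R :=
  fine (\esum_(x in [set: V]) ((EFin \o F)^\+ x)%E) -
  fine (\esum_(x in [set: V]) ((EFin \o F)^\- x)%E).

Definition csum (F : V -> R[i]) : R[i] :=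
  rsum (fun x => complex.Re (F x)) +i* rsum (fun x => complex.Im (F x)).

End absolutely_convergent_sums.

Section ell2.
Context {R : realType} {V : countType}.
Variable m : V -> R.

Definition ell2_pred : pred (V -> R[i]) := fun f =>
  `[< summable [set: V] (fun x => (m x * Normc.normc (f x) ^+ 2)%:E) >].

Lemma normcD_sqr (z w : R[i]) :
  Normc.normc (z + w) ^+ 2 <= Normc.normc z ^+ 2 *+ 2 + Normc.normc w ^+ 2 *+ 2.
Proof.
case: z w => [a c] [d e] /=.
rewrite !sqr_sqrtr ?addr_ge0 ?sqr_ge0//.
rewrite -subr_ge0.
have -> : (a ^+ 2 + c ^+ 2) *+ 2 + (d ^+ 2 + e ^+ 2) *+ 2 -
    ((a + d) ^+ 2 + (c + e) ^+ 2) = (a - d) ^+ 2 + (c - e) ^+ 2 by ring.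
by rewrite addr_ge0 ?sqr_ge0.
Qed.

Lemma summable_scale (k : R) (u : V -> \bar R) :
  summable [set: V] u -> summable [set: V] (fun x => k%:E * u x)%E.
Proof.
rewrite /summable => su.
have S0 : (0 <= \esum_(x in [set: V]) `|u x|)%E by apply: esum_ge0.
apply: (@le_lt_trans _ _ (`|k|%:E * \esum_(x in [set: V]) `|u x|)%E); last first.
  by rewrite lte_mul_pinfty ?lee_fin// ge0_fin_numE.
apply: ge_ereal_sup => _ [A [finA _] <-].
under eq_fsbigr do rewrite abseM abse_EFin.
rewrite -ge0_mule_fsumr//.
by apply: lee_wpmul2l; rewrite ?lee_fin//; apply: esum_ge; exists A.
Qed.

Lemma ell2_submod_closed : submod_closed ell2_pred.
Proof.
split=> [|a f g].
  apply/asboolP; rewrite /summable esum1 ?ltry// => x _.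
  rewrite (_ : Normc.normc _ = 0); last exact: Normc.normc0.
  by rewrite expr0n/= mulr0 normr0.
move=> /asboolP sf /asboolP sg; apply/asboolP.
pose F (h : V -> R[i]) x : \bar R := (m x * Normc.normc (h x) ^+ 2)%:E.
pose k := Normc.normc a ^+ 2 *+ 2.
have sG : summable [set: V] (fun x => k%:E * F f x + 2%:E * F g x)%E.
  by apply: summableD; apply: summable_scale.
apply: le_lt_trans sG; apply: le_esum => x _.
rewrite /F -!EFinM -EFinD !abse_EFin lee_fin.
rewrite [k * _]mulrCA [2 * _]mulrCA -mulrDr.
rewrite (normrM (m x)) (normrM (m x) (_ + _)) ler_wpM2l//.
have k0 : 0 <= k by rewrite mulrn_wge0 ?sqr_ge0.
rewrite [X in X <= _]ger0_norm ?sqr_ge0// ger0_norm; last first.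
  by apply: addr_ge0; apply: mulr_ge0; rewrite ?sqr_ge0.
apply: le_trans (normcD_sqr _ _) _.
by rewrite [(a *: f) x]/(a * f x) Normc.normcM exprMn -mulrnAl mulr_natl.
Qed.

HB.instance Definition _ :=
  GRing.isSubmodClosed.Build _ _ ell2_pred ell2_submod_closed.

Record ell2 := Ell2 { ell2_fun :> V -> R[i] ; _ : ell2_fun \in ell2_pred }.

HB.instance Definition _ := [isSub for ell2_fun].
HB.instance Definition _ := [Choice of ell2 by <:].
HB.instance Definition _ := [SubChoice_isSubLmodule of ell2 by <:].

Definition ell2_dot (f g : ell2) : R[i] :=
  csum (fun x => (m x)%:C * (f x * (g x)^*)).

End ell2.
Arguments ell2_dot {R V} m f g.

(* Operators on a Hilbert space H with scalar product dot (linear in the first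
   argument), identified with their graphs in H * H. *)
Section unbounded_operators.
Context {R : realType} {H : lmodType R[i]}.
Variable dot : H -> H -> R[i].
Implicit Types A T : set (H * H).

Definition hnorm (f : H) : R := Num.sqrt (complex.Re (dot f f)).

Definition is_operator A :=
  [/\ A 0,
      forall (a : R[i]) p q, A p -> A q -> A (a *: p + q) &
      forall f g h, A (f, g) -> A (f, h) -> g = h].

Definition op_dom A : set H := [set f | exists g, A (f, g)].

(* The closure of the graph in H * H; A is closable exactly when this graph
   is an operator again. *)
Definition op_closure A : set (H * H) :=
  [set p | exists u : nat -> H * H,
    [/\ forall n, A (u n),
        hnorm ((u n).1 - p.1) @[n --> \oo] --> (0 : R) &
        hnorm ((u n).2 - p.2) @[n --> \oo] --> (0 : R)]].

(* the graph of A + z *)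
Definition op_shift A (z : R[i]) : set (H * H) :=
  [set p | A (p.1, p.2 - z *: p.1)].

Definition op_inv A : set (H * H) := [set p | A (p.2, p.1)].

Definition op_norm T : \bar R :=
  ereal_sup [set (hnorm p.2)%:E | p in [set p | T p /\ hnorm p.1 <= 1]].

(* z is in the resolvent set iff A - z is a bijection from its domain onto H
   with bounded inverse. *)
Definition resolvent_set A : set R[i] :=
  [set z | let T := op_inv (op_shift A (- z)) in
    [/\ is_operator T, op_dom T = [set: H] & (op_norm T < +oo)%E]].

Definition accretive A :=
  is_operator A /\ forall f g, A (f, g) -> 0 <= complex.Re (dot g f).

Definition m_accretive A :=
  [/\ accretive A,
      [set z : R[i] | complex.Re z < 0] `<=` resolvent_set A &
      forall z : R[i], 0 < complex.Re z ->
        (op_norm (op_inv (op_shift A z)) <= ((complex.Re z)^-1)%:E)%E].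

End unbounded_operators.

Section laplacian.
Context {R : realType} {V : countType}.
Variables (b : V -> V -> R) (m : V -> R).

Definition formal_laplacian (f : V -> R[i]) : V -> R[i] := fun x =>
  ((m x)^-1)%:C * \sum_(y \in [set: V]) ((b x y)%:C * (f x - f y)).

(* By [op_dom_laplacian], for a locally finite graph the condition that the
   image be in l^2(V, m) does not restrict the domain C_c(V). *)
Definition laplacian : set (ell2 m * ell2 m) :=
  [set p : ell2 m * ell2 m |
     Cc (p.1 : V -> R[i]) /\ (p.2 : V -> R[i]) = formal_laplacian p.1].

Lemma Cc_ell2 (f : V -> R[i]) : Cc f -> f \in ell2_pred m.
Proof.
move=> finf; apply/asboolP; rewrite /summable.
rewrite (_ : esum _ _ =
    \esum_(x in [set x | f x != 0%R]) `|(m x * Normc.normc (f x) ^+ 2)%:E|)%E.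
  rewrite esum_fset// fsbig_finite//=.
  by rewrite sumEFin ltry.
rewrite [RHS]esum_mkcond; apply: eq_esum => x _.
case: ifPn => // /negP fx; have -> : f x = 0.
  by apply/eqP; apply: contra_notT fx => ?; apply/mem_set.
by rewrite (Normc.normc0 R) expr0n/= mulr0 normr0.
Qed.

Lemma formal_laplacian_Cc (f : V -> R[i]) : (forall x y, 0 <= b x y) ->
  locally_finite b -> Cc f -> Cc (formal_laplacian f).
Proof.
move=> b0 lf finf; pose S := [set x | f x != 0].
apply: (@sub_finite_set _ _ (S `|` \bigcup_(y in S) neighbours b y)).
  move=> x /=; apply: contra_neqP => /not_orP[Sx NSx].
  have fx : f x = 0 by apply: contra_notP Sx => /eqP.
  rewrite /formal_laplacian fsbig1 ?mulr0// => y _.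
  have [->|fy] := eqVneq (f y) 0; first by rewrite fx subr0 mulr0.
  have [->|bxy] := eqVneq (b x y) 0; first by rewrite mul0r.
  exfalso; apply: NSx; exists y => //.
  by rewrite /neighbours/= /adjacent orbC lt0r bxy b0.
rewrite finite_setU; split => //.
by apply: bigcup_finite => // y _; exact: lf.
Qed.

Lemma op_dom_laplacian : (forall x y, 0 <= b x y) -> locally_finite b ->
  op_dom laplacian = [set f : ell2 m | Cc (f : V -> R[i])].
Proof.
move=> b0 lf; apply/seteqP; split=> [f [g []]//|f /= Ccf].
by exists (Ell2 (Cc_ell2 (formal_laplacian_Cc b0 lf Ccf))).
Qed.

End laplacian.
Arguments laplacian {R V} b m _.

(* Main.v *)
Require Import Defs.
From mathcomp Require Import all_boot all_order all_algebra.
From mathcomp Require Import complex.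
From mathcomp Require Import all_classical all_reals all_analysis.
From mathcomp Require Import ring lra.

(** The operator theory is the criterion [m_accretive_closure]: if [A] is
    accretive and closable on a Hilbert space, and no nonzero vector is
    orthogonal to the range of [A + z] when [Re z > 0], then the closure of [A]
    is m-accretive. Accretivity gives [Re z * |f| <= |(A + z) f|]
    ([accretive_lower_bound]), which passes to the closure, bounds the inverse
    of [A + z] by [1 / Re z], and makes the range of the closure of [A + z]
    closed; this range is also dense by orthogonal projection
    ([orthogonal_decomposition]), so it is the whole space.

    Closability of the Laplacian holds because convergence in l^2(V, m) is
    pointwise and [formal_laplacian] at a vertex involves finitely many values
    ([op_closure_laplacian_formal]).

    The heart of the matter is [laplacian_shift_orthogonal0]: a vector [r]
    orthogonal to the range of [Delta + z] vanishes. It is tested against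
    [chi_n^2 r], where [chi_n] is a cutoff of the chi-completeness hypothesis.
    Kirchhoff's law allows one to complete the square: for real [v] and [s],
      sum b(x,y) (s(x)^2 v(x) - s(y)^2 v(y)) v(x)
        = 1/2 sum b(x,y) (s(x) v(x) - s(y) v(y))^2
          + sum b(x,y) s(y) (s(x) - s(y)) v(x) v(y)
    ([balanced_energy]). The first sum on the right is nonnegative. Exchanging
    [x] and [y] in the second one brings out a further factor [s(x) - s(y)] in
    front of the symmetric part of [b]; only the antisymmetric part remains of
    first order. For [0 <= s <= 1] the second sum is therefore at least
      - 1/2 sum_x v(x)^2 sum_y k(x,y),
      k(x,y) = b'(x,y) (s(x) - s(y))^2 + |b(x,y) - b(y,x)| |s(x) - s(y)|
    ([balanced_energy_ge]). By the arithmetic-geometric inequality the two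
    hypotheses on the graph imply [sum_y k(x,y) <= C m(x)]
    ([cutoff_cost_row_le]). Since [chi_n] is eventually 1 around any given
    vertex, the error term is bounded by a tail of a convergent series and
    tends to 0, and what remains is [Re z * |chi_n r|^2 <= o(1)].

    The same identity with [s] the indicator of the support of [v] has no error
    term at all and yields accretivity ([laplacian_accretive]). *)

Set Implicit Arguments.
Unset Strict Implicit.
Unset Printing Implicit Defensive.

Import Order.TTheory GRing.Theory Num.Theory.
Import numFieldNormedType.Exports.
Local Open Scope classical_set_scope.
Local Open Scope ring_scope.

(** * Hermitian spaces *)

Section hermitian_spaces.
Context {R : realType} {H : lmodType R[i]}.
Variable dot : H -> H -> R[i].

Record hermitian_product : Prop := HermitianProduct {
  hdotDl : forall f g h, dot (f + g) h = dot f h + dot g h;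
  hdotZl : forall a f g, dot (a *: f) g = a * dot f g;
  hdotC : forall f g, dot g f = conjc (dot f g);
  hdot_ge0 : forall f, 0 <= complex.Re (dot f f);
  hdot_eq0 : forall f, complex.Re (dot f f) = 0 -> f = 0 }.

Definition hcomplete := forall u : nat -> H,
  (forall e, 0 < e -> exists N, forall n p, (N <= n)%N -> (N <= p)%N ->
     hnorm dot (u n - u p) <= e) ->
  exists l, hnorm dot (u n - l) @[n --> \oo] --> (0 : R).

Hypothesis dotP : hermitian_product.

Local Notation nrm := (hnorm dot).
Local Notation rdot f g := (complex.Re (dot f g)).

Lemma rdotC f g : rdot f g = rdot g f.
Proof. by rewrite (hdotC dotP); case: (dot g f). Qed.

Lemma rdotDl f g h : rdot (f + g) h = rdot f h + rdot g h.
Proof. by rewrite (hdotDl dotP); case: (dot f h) (dot g h) => [? ?] []. Qed.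

Lemma rdotDr f g h : rdot f (g + h) = rdot f g + rdot f h.
Proof. by rewrite rdotC rdotDl rdotC (rdotC h). Qed.

Lemma rdotZl (r : R) f g : rdot (r%:C%C *: f) g = r * rdot f g.
Proof.
by rewrite (hdotZl dotP); case: (dot f g) => x y /=; rewrite mul0r subr0.
Qed.

Lemma rdotZr (r : R) f g : rdot f (r%:C%C *: g) = r * rdot f g.
Proof. by rewrite rdotC rdotZl rdotC. Qed.

Lemma rdotNl f g : rdot (- f) g = - rdot f g.
Proof.
have -> : - f = (- 1 : R)%:C%C *: f by rewrite rmorphN1 scaleN1r.
by rewrite rdotZl mulN1r.
Qed.

Lemma rdotNr f g : rdot f (- g) = - rdot f g.
Proof. by rewrite rdotC rdotNl rdotC. Qed.

Lemma rdot0r f : rdot f 0 = 0.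
Proof. by have := rdotDr f 0 0; rewrite addr0; lra. Qed.

Lemma hdot_Im f : complex.Im (dot f f) = 0.
Proof.
have := hdotC dotP f f; case: (dot f f) => x y [] /= /eqP.
by rewrite -subr_eq0 opprK -mulr2n mulrn_eq0 => /eqP.
Qed.

Lemma rdot_scale_self a f : rdot (a *: f) f = complex.Re a * rdot f f.
Proof.
rewrite (hdotZl dotP); have := hdot_Im f.
by case: a (dot f f) => [x y] [z t] /= ->; rewrite mulr0 subr0.
Qed.

Lemma sqr_hnorm f : nrm f ^+ 2 = rdot f f.
Proof. by rewrite sqr_sqrtr// (hdot_ge0 dotP). Qed.

Lemma hnorm_ge0 f : 0 <= nrm f. Proof. exact: sqrtr_ge0. Qed.

Lemma hnorm0 : nrm 0 = 0.
Proof.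
have /(congr1 (@complex.Re R)) := hdotZl dotP 0 0 0.
by rewrite scale0r mul0r /hnorm => ->; rewrite sqrtr0.
Qed.

Lemma hnorm_eq0 f : nrm f = 0 -> f = 0.
Proof. by move=> f0; apply: (hdot_eq0 dotP); rewrite -sqr_hnorm f0 expr0n. Qed.

Lemma hnormZ a f : nrm (a *: f) = Normc.normc a * nrm f.
Proof.
apply/eqP; rewrite -(@eqrXn2 _ 2)// ?hnorm_ge0 ?mulr_ge0 ?hnorm_ge0//;
  last first.
  by case: a => ? ?; exact: sqrtr_ge0.
rewrite exprMn !sqr_hnorm (hdotZl dotP) (hdotC dotP) (hdotZl dotP).
have := hdot_Im f; case: a (dot f f) => [x y] [z t] /= ->.
rewrite sqr_sqrtr ?addr_ge0 ?sqr_ge0//.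
by apply/eqP; ring.
Qed.

Lemma hnormN f : nrm (- f) = nrm f.
Proof. by rewrite /hnorm rdotNl rdotNr opprK. Qed.

Lemma hdistC f g : nrm (f - g) = nrm (g - f).
Proof. by rewrite -hnormN opprB. Qed.

(** The squared norm of [<g,g> f - <f,g> g], with real scalar products, equals
    [<g,g> (<g,g> <f,f> - <f,g>^2)] and is nonnegative. *)
Lemma cauchy_schwarz f g : `|rdot f g| <= nrm f * nrm g.
Proof.
rewrite -(@ler_pXn2r _ 2)// ?nnegrE ?mulr_ge0 ?hnorm_ge0//.
rewrite exprMn !sqr_hnorm real_normK ?num_real//.
have [g0|g0] := eqVneq (rdot g g) 0.
  by rewrite (hdot_eq0 dotP g0) !rdot0r expr0n mulr0.
have gg : 0 < rdot g g by rewrite lt0r g0 (hdot_ge0 dotP).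
have : 0 <= rdot ((rdot g g)%:C%C *: f - (rdot f g)%:C%C *: g)
                 ((rdot g g)%:C%C *: f - (rdot f g)%:C%C *: g).
  exact: hdot_ge0.
rewrite rdotDl !rdotDr !rdotNl !rdotNr !rdotZl !rdotZr (rdotC g f).
set c := rdot g g; set r := rdot f g; set a := rdot f f => h.
rewrite -subr_ge0 -(pmulr_rge0 _ gg) -/c.
by apply: le_trans h _; rewrite le_eqVlt; apply/orP; left; apply/eqP; ring.
Qed.

Lemma hnormD f g : nrm (f + g) <= nrm f + nrm g.
Proof.
rewrite -(@ler_pXn2r _ 2)// ?nnegrE ?addr_ge0 ?hnorm_ge0//.
rewrite sqrrD !sqr_hnorm rdotDl !rdotDr (rdotC g f).
have := le_trans (ler_norm _) (cauchy_schwarz f g); lra.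
Qed.

Lemma hdist_triangle f g h : nrm (f - h) <= nrm (f - g) + nrm (g - h).
Proof. by rewrite -[f - h](subrKA g) hnormD. Qed.

Lemma hnorm_parallelogram f g :
  nrm (f + g) ^+ 2 + nrm (f - g) ^+ 2 = 2 * nrm f ^+ 2 + 2 * nrm g ^+ 2.
Proof.
rewrite !sqr_hnorm !(rdotDl, rdotDr, rdotNl, rdotNr) (rdotC g f).
by ring.
Qed.

Lemma squeeze_cvg0 (u : nat -> R) (e : nat -> R) :
  (forall n, 0 <= u n <= e n) -> e @ \oo --> (0 : R) -> u @ \oo --> (0 : R).
Proof.
move=> ue e0; apply: (squeeze_cvgr _ (cvg_cst 0) e0).
by near=> n; exact: ue.
Unshelve. all: by end_near. Qed.

Lemma hcvg_linear a (f g : nat -> H) l k :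
  nrm (f n - l) @[n --> \oo] --> (0 : R) ->
  nrm (g n - k) @[n --> \oo] --> (0 : R) ->
  nrm ((a *: f n + g n) - (a *: l + k)) @[n --> \oo] --> (0 : R).
Proof.
move=> fl gk.
apply: (@squeeze_cvg0 _
  (fun n => Normc.normc a * nrm (f n - l) + nrm (g n - k))).
  move=> n; rewrite hnorm_ge0/= -hnormZ.
  by rewrite opprD addrACA -scalerBr hnormD.
rewrite -[X in _ --> X](_ : Normc.normc a * 0 + 0 = 0); last first.
  by rewrite mulr0 addr0.
by apply: cvgD => //; apply: cvgMr.
Qed.

Lemma hcvg_rdot (f g : nat -> H) l k :
  nrm (f n - l) @[n --> \oo] --> (0 : R) ->
  nrm (g n - k) @[n --> \oo] --> (0 : R) ->
  rdot (f n) (g n) @[n --> \oo] --> rdot l k.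
Proof.
move=> fl gk; apply/subr_cvg0.
apply: norm_cvg0.
apply: (@squeeze_cvg0 _ (fun n => nrm (f n - l) * nrm (g n - k) +
   nrm (f n - l) * nrm k + nrm l * nrm (g n - k))).
  move=> n; rewrite normr_ge0/=.
  have -> : rdot (f n) (g n) - rdot l k =
    rdot (f n - l) (g n - k) + rdot (f n - l) k + rdot l (g n - k).
    by rewrite !rdotDl !rdotDr !rdotNl !rdotNr; ring.
  apply: le_trans (ler_normD _ _) _; rewrite lerD ?cauchy_schwarz//.
  by apply: le_trans (ler_normD _ _) _; rewrite lerD ?cauchy_schwarz.
have -> : 0 = 0 * 0 + 0 * nrm k + nrm l * 0 :> R by rewrite !mul0r mulr0 !addr0.
by apply: cvgD; [apply: cvgD; [exact: cvgM|exact: cvgMl]|exact: cvgMr].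
Qed.

End hermitian_spaces.

Section orthogonal_decomposition.
Context {R : realType} {H : lmodType R[i]}.
Variable dot : H -> H -> R[i].
Hypothesis dotP : hermitian_product dot.
Local Notation nrm := (hnorm dot).
Local Notation rdot f g := (complex.Re (dot f g)).

Lemma invS_lt_eventually (e : R) : 0 < e ->
  exists N, forall n, (N <= n)%N -> n.+1%:R^-1 < e.
Proof.
move=> e0; have [N _ HN] := near_infty_natSinv_lt (PosNum e0).
by exists N => n Nn; exact: HN.
Qed.

(** Projection onto the closure of [W]: by the parallelogram identity, a
    sequence of [W] that minimizes the distance to [h] is Cauchy, and the
    variations [w n + c f] show that the limit of [h - w n] is orthogonal to
    [W]. *)
Lemma orthogonal_decomposition (W : set H) (h : H) :
  hcomplete dot -> W 0 ->
  (forall (a : R[i]) f g, W f -> W g -> W (a *: f + g)) ->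
  exists (w : nat -> H) (r : H),
    [/\ forall n, W (w n),
        nrm ((h - w n) - r) @[n --> \oo] --> (0 : R) &
        forall f, W f -> rdot f r = 0].
Proof.
move=> Hc W0 Wlin.
pose S := [set nrm (h - w) ^+ 2 | w in W].
have Slb : lbound S 0 by move=> _ [w _ <-]; rewrite sqr_ge0.
have Sinf : has_inf S.
  by split; [exists (nrm (h - 0) ^+ 2), 0 | exists 0].
pose d := inf S.
have d_le w : W w -> d <= nrm (h - w) ^+ 2.
  by move=> Ww; apply: ge_inf; [exists 0|exists w].
have /choice[w wP] n : exists w, W w /\ nrm (h - w) ^+ 2 < d + n.+1%:R^-1.
  have n0 : 0 < n.+1%:R^-1 :> R by rewrite invr_gt0.
  by have [_ [w Ww <-] ?] := inf_adherent n0 Sinf; exists w.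
have Ww n : W (w n) by have [] := wP n.
have wd n : nrm (h - w n) ^+ 2 < d + n.+1%:R^-1 by have [] := wP n.
have Cw n p : nrm ((h - w n) - (h - w p)) ^+ 2 <=
    2 * n.+1%:R^-1 + 2 * p.+1%:R^-1.
  have := hnorm_parallelogram dotP (h - w n) (h - w p).
  have -> : (h - w n) + (h - w p) =
      2%:C%C *: (h - ((2^-1)%:C%C *: w n + ((2^-1)%:C%C *: w p + 0))).
    rewrite addr0 scalerBr scalerDr !scalerA -!rmorphM/= divff// !scale1r.
    by rewrite rmorph_nat scaler_nat mulr2n addrACA opprD.
  rewrite (hnormZ dotP) exprMn /= expr0n addr0 sqr_sqrtr ?sqr_ge0//.
  have := d_le _ (Wlin _ _ _ (Ww n) (Wlin _ _ _ (Ww p) W0)).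
  have := wd n; have := wd p.
  move=> h1 h2 h3 h4; have h5 := h3 (2^-1)%:C%C (2^-1)%:C%C.
  move: h1 h2 h4 h5; move: (n.+1%:R^-1) (p.+1%:R^-1) => a1 a2; lra.
have [|r hr] := Hc (fun n => h - w n).
  move=> e e0.
  have e4 : 0 < e ^+ 2 / 4 by rewrite divr_gt0 ?exprn_gt0.
  have [N NP] := invS_lt_eventually e4; exists N => n p Nn Np.
  rewrite -(@ler_pXn2r _ 2)// ?nnegrE ?(ltW e0) ?hnorm_ge0//.
  have := Cw n p; have := NP _ Nn; have := NP _ Np.
  move: (n.+1%:R^-1) (p.+1%:R^-1) => a1 a2; lra.
exists w, r; split=> // f Wf.
(* Minimality against the competitor w n + c f, in the limit in n. *)
have fc (c : R) : 0 <= c ^+ 2 * nrm f ^+ 2 - c * (2 * rdot r f).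
  have cvf : (n.+1%:R^-1 + (c ^+ 2 * nrm f ^+ 2 - c * (2 * rdot (h - w n) f)))
      @[n --> \oo] --> 0 + (c ^+ 2 * nrm f ^+ 2 - c * (2 * rdot r f)).
    apply: cvgD; first exact: cvg_harmonic.
    apply: cvgB; first exact: cvg_cst.
    apply: cvgMr; apply: cvgMr; apply: (hcvg_rdot dotP) => //.
    by rewrite subrr (hnorm0 dotP); exact: cvg_cst.
  rewrite -[leRHS]add0r.
  apply: (cvgr_to_ge cvf).
  near=> n.
  have := d_le _ (Wlin c%:C%C _ _ Wf (Ww n)).
  have -> : h - (c%:C%C *: f + w n) = (h - w n) + (- c)%:C%C *: f.
    by rewrite opprD addrCA rmorphN scaleNr addrC.
  move: (h - w n) (wd n) => k; move: (n.+1%:R^-1) => a1.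
  rewrite [nrm (_ + _) ^+ 2](sqr_hnorm dotP) !(rdotDl dotP) !(rdotDr dotP).
  rewrite !(rdotZl dotP) !(rdotZr dotP) (rdotC dotP f) -!(sqr_hnorm dotP).
  lra.
rewrite (rdotC dotP); set k := rdot r f; set q := nrm f ^+ 2.
have q0 : 0 <= q by exact: sqr_ge0.
(* The optimal c is k / q; the added 1 avoids a case distinction on q = 0. *)
have := fc (k / (q + 1)); rewrite -/k -/q.
have -> : (k / (q + 1)) ^+ 2 * q - k / (q + 1) * (2 * k) =
  - ((q + 2) * (k / (q + 1)) ^+ 2) by field; lra.
rewrite oppr_ge0 pmulr_rle0; last lra.
move=> h0; have : (k / (q + 1)) ^+ 2 == 0 by rewrite eq_le h0 sqr_ge0.
rewrite sqrf_eq0 mulf_eq0 invr_eq0 => /orP[/eqP//|/eqP]; lra.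
Unshelve. all: by end_near. Qed.

End orthogonal_decomposition.

(** * Closures of accretive operators *)

Section accretive_closure.
Context {R : realType} {H : lmodType R[i]}.
Variable dot : H -> H -> R[i].
Hypothesis dotP : hermitian_product dot.
Local Notation nrm := (hnorm dot).
Local Notation rdot f g := (complex.Re (dot f g)).
Implicit Types A : set (H * H).

Lemma op_closure_linear A : is_operator A ->
  op_closure dot A 0 /\
  forall (a : R[i]) p q, op_closure dot A p -> op_closure dot A q ->
    op_closure dot A (a *: p + q).
Proof.
move=> [A0 Alin _]; split.
  by exists (fun=> 0); split=> //; rewrite subrr (hnorm0 dotP); exact: cvg_cst.
move=> a p q [u [Au u1 u2]] [v [Av v1 v2]].
exists (fun n => a *: u n + v n); split=> [n||]; first exact: Alin.
- exact: (hcvg_linear dotP).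
- exact: (hcvg_linear dotP).
Qed.

Lemma accretive_closure A : accretive dot A ->
  (forall f g h, op_closure dot A (f, g) -> op_closure dot A (f, h) -> g = h) ->
  accretive dot (op_closure dot A).
Proof.
move=> [Aop Aacc] Afun; split.
  by have [? ?] := op_closure_linear Aop; split.
move=> f g [u [Au u1 u2]].
apply: (cvgr_to_ge (hcvg_rdot dotP u2 u1)); near=> n.
by apply: Aacc; rewrite -surjective_pairing.
Unshelve. all: by end_near. Qed.

(** Pair [g + z f] with [f]: accretivity leaves at least [Re z |f|^2]. *)
Lemma accretive_lower_bound A (z : R[i]) f g : accretive dot A -> A (f, g) ->
  complex.Re z * nrm f <= nrm (g + z *: f).
Proof.
move=> [_ Aacc] Afg.
have [f0|f0] := eqVneq (nrm f) 0; first by rewrite f0 mulr0 hnorm_ge0.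
have fp : 0 < nrm f by rewrite lt0r f0 hnorm_ge0.
rewrite -(ler_pM2r fp) -mulrA -expr2 (sqr_hnorm dotP).
apply: le_trans (le_trans (ler_norm _) (cauchy_schwarz dotP _ _)).
by rewrite (rdotDl dotP) (rdot_scale_self dotP) lerDr; exact: Aacc.
Qed.

(** The range of [A + z] comes arbitrarily close to [h], having no nonzero
    orthogonal vector, and the lower bound turns approximations
    [p.2 + z p.1 -> h] into a Cauchy sequence of preimages [p.1]. *)
Lemma op_closure_shift_onto A (z : R[i]) (h : H) : hcomplete dot ->
  accretive dot A -> 0 < complex.Re z ->
  (forall r, (forall p, A p -> rdot (p.2 + z *: p.1) r = 0) -> r = 0) ->
  exists f, op_closure dot A (f, h - z *: f).
Proof.
move=> Hc Aacc z0 Aperp; have [[A0 Alin Afun] _] := Aacc.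
pose W := [set p.2 + z *: p.1 | p in A].
have W0 : W 0 by exists 0 => //=; rewrite scaler0 addr0.
have Wlin (a : R[i]) f g : W f -> W g -> W (a *: f + g).
  move=> [p Ap <-] [q Aq <-]; exists (a *: p + q); first exact: Alin.
  by rewrite /= !scalerDr !scalerA (mulrC z) addrACA.
have [w [r [Ww hw Wr]]] := orthogonal_decomposition dotP h Hc W0 Wlin.
have r0 : r = 0 by apply: Aperp => p Ap; apply: Wr; exists p.
have /choice[p pP] n : exists p, A p /\ p.2 + z *: p.1 = w n.
  by have [p Ap <-] := Ww n; exists p.
have {}hw : nrm (w n - h) @[n --> \oo] --> (0 : R).
  by rewrite r0 in hw; under eq_fun do rewrite (hdistC dotP) -[_ - _]subr0.
have [|f pf] := Hc (fun n => (p n).1).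
  move=> e e0.
  have ez : 0 < complex.Re z * e / 2 by rewrite !mulr_gt0.
  have [N _ NP] : \forall n \near \oo,
      `|nrm (w n - h)| < complex.Re z * e / 2 by apply: cvgr0_norm_lt.
  exists N => n k Nn Nk.
  rewrite -(ler_pM2l z0).
  have Ank : A ((p n).1 - (p k).1, (p n).2 - (p k).2).
    have := Alin (-1) _ _ (pP k).1 (pP n).1.
    by rewrite !scaleN1r addrC.
  apply: le_trans (accretive_lower_bound z Aacc Ank) _.
  rewrite scalerBr addrACA -opprD (pP n).2 (pP k).2.
  apply: le_trans (hdist_triangle dotP _ h _) _.
  rewrite (hdistC dotP h).
  have := NP _ Nn; have := NP _ Nk.
  rewrite /= !ger0_norm ?hnorm_ge0//; lra.
exists f; exists p; split=> [n|//|]; first exact: (pP n).1.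
have E n : (p n).2 - (h - z *: f) = - z *: (p n).1 + w n - (- z *: f + h).
  rewrite -(pP n).2 !scaleNr [_ - z *: f]addrC.
  by rewrite [- _ + (_ + _)]addrCA addNr addr0.
by under eq_fun do rewrite /= E; exact: (hcvg_linear dotP).
Qed.

(** Injectivity of [A + z] and the bound on its inverse are both instances of
    the lower bound. *)
Lemma accretive_resolvent A (z : R[i]) : accretive dot A -> 0 < complex.Re z ->
  is_operator (op_inv (op_shift A z)) /\
  (op_norm dot (op_inv (op_shift A z)) <= ((complex.Re z)^-1)%:E)%E.
Proof.
move=> Aacc z0; have [[A0 Alin Afun] _] := Aacc; split.
  split.
  - by rewrite /op_inv /op_shift /= scaler0 subr0.
  - move=> a [f g] [h k]; rewrite /op_inv /op_shift /= => Afg Ahk.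
    have Agk : A (a *: g + k, a *: (f - z *: g) + (h - z *: k)).
      exact: Alin Afg Ahk.
    suff E : a *: (f - z *: g) + (h - z *: k) = a *: f + h - z *: (a *: g + k).
      by rewrite E in Agk.
    by rewrite scalerBr scalerDr !scalerA (mulrC z) opprD addrACA.
  - move=> f g h; rewrite /op_inv /op_shift /= => Ag Ah.
    have Agh : A (-1 *: h + g, -1 *: (f - z *: h) + (f - z *: g)).
      exact: Alin Ah Ag.
    have := accretive_lower_bound z Aacc Agh; rewrite !scaleN1r.
    have -> : - (f - z *: h) + (f - z *: g) + z *: (- h + g) = 0.
      by rewrite opprB addrA subrK scalerDr scalerN addrACA subrr addNr addr0.
    rewrite (hnorm0 dotP) pmulr_rle0// => gh0.
    have /(hnorm_eq0 dotP)/eqP : nrm (- h + g) = 0.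
      by apply/eqP; rewrite eq_le gh0 hnorm_ge0.
    by rewrite addrC subr_eq0 => /eqP.
apply: ge_ereal_sup => _ [[f g] [Afg /= f1] <-].
rewrite lee_fin -(ler_pM2l z0) mulfV ?gt_eqF//.
apply: le_trans f1; apply: le_trans (accretive_lower_bound z Aacc Afg) _.
by rewrite subrK.
Qed.

(** The Lumer-Phillips criterion, in the form suited to an operator given on a
    core: density of the range of [A + z] is expressed by orthogonality. *)
Theorem m_accretive_closure A : hcomplete dot -> accretive dot A ->
  (forall f g h, op_closure dot A (f, g) -> op_closure dot A (f, h) -> g = h) ->
  (forall z r, 0 < complex.Re z ->
    (forall p, A p -> rdot (p.2 + z *: p.1) r = 0) -> r = 0) ->
  m_accretive dot (op_closure dot A).
Proof.
move=> Hc Aacc Afun Aperp.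
have Cacc := accretive_closure Aacc Afun.
split=> // [z /= z0|z z0]; last exact: (accretive_resolvent Cacc z0).2.
have nz0 : 0 < complex.Re (- z) by case: z z0 => x y /=; rewrite oppr_gt0.
have [Top Tn] := accretive_resolvent Cacc nz0.
split=> //; last exact: le_lt_trans Tn (ltry _).
apply/seteqP; split=> // h _.
have [f fP] := op_closure_shift_onto h Hc Aacc nz0 (fun r => Aperp _ r nz0).
by exists f.
Qed.

End accretive_closure.

(** * Absolutely convergent sums *)

Lemma ler_sum_support {R : numDomainType} {I : eqType} (P : I -> R)
    (D E : seq I) :
  uniq D -> uniq E -> (forall x, 0 <= P x) ->
  (forall x, x \notin E -> P x = 0) ->
  \sum_(x <- D) P x <= \sum_(x <- E) P x.
Proof.
move=> uD uE P0 PE; rewrite (bigID (mem E))/= [X in _ + X]big1 ?addr0//.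
rewrite -big_filter [leRHS](bigID (mem D))/= -[X in _ <= X + _]big_filter.
rewrite (perm_big [seq x <- E | x \in D]) ?lerDl ?sumr_ge0//.
by apply: uniq_perm; rewrite ?filter_uniq// => x; rewrite !mem_filter andbC.
Qed.

Section summable_sums.
Context {R : realType} {V : countType}.
Implicit Types F G P Q : V -> R.

Definition summableR F := summable [set: V] (EFin \o F).

(** Sums of nonnegative families are the only ones for which additivity is
    inherited from [\esum]; [rsum] is reduced to them by [rsumB]. *)
Definition nnsum P : R := fine (\esum_(x in [set: V]) (P x)%:E)%E.

Lemma summableRD F G : summableR F -> summableR G ->
  summableR (fun x => F x + G x).
Proof. exact: summableD. Qed.

Lemma le_summableR F G : summableR G -> (forall x, `|F x| <= `|G x|) ->
  summableR F.
Proof.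
move=> sG FG; apply: le_lt_trans sG; apply: le_esum => x _.
by rewrite !abse_EFin lee_fin.
Qed.

Lemma summableRZ (a : R) F : summableR F -> summableR (fun x => a * F x).
Proof. exact: summable_scale. Qed.

Lemma summableR_norm F : summableR F -> summableR (fun x => `|F x|).
Proof. by move=> sF; apply: (le_summableR sF) => x; rewrite normr_id. Qed.

Lemma esum_le_bound P (c : R) :
  (forall D : seq V, uniq D -> \sum_(x <- D) P x <= c) ->
  (\esum_(x in [set: V]) (P x)%:E <= c%:E)%E.
Proof.
move=> Pc; apply: ge_ereal_sup => _ [A [finA _] <-].
rewrite fsbig_finite//= sumEFin lee_fin; apply: Pc; exact: finmap.fset_uniq.
Qed.

Lemma le_partial_esum P (D : seq V) : uniq D ->
  ((\sum_(x <- D) P x)%:E <= \esum_(x in [set: V]) (P x)%:E)%E.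
Proof.
move=> uD; apply: esum_ge; exists [set` D].
  by split=> [|//]; exact: finite_seq.
by rewrite -fsbig_seq// sumEFin.
Qed.

Lemma bounded_summableR P (c : R) : (forall x, 0 <= P x) ->
  (forall D : seq V, uniq D -> \sum_(x <- D) P x <= c) -> summableR P.
Proof.
move=> P0 Pc; apply: (@le_lt_trans _ _ c%:E); last exact: ltry.
rewrite (_ : (fun _ => _) = (fun x => (P x)%:E)); first exact: esum_le_bound.
by apply/funext => x /=; rewrite ger0_norm.
Qed.

Lemma esumEnnsum P : summableR P -> (forall x, 0 <= P x) ->
  (\esum_(x in [set: V]) (P x)%:E = (nnsum P)%:E)%E.
Proof.
move=> sP P0; rewrite fineK// ge0_fin_numE; last first.
  by apply: esum_ge0 => x _; rewrite lee_fin.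
apply: le_lt_trans sP; apply: le_esum => x _.
by rewrite abse_EFin lee_fin ler_norm.
Qed.

Lemma le_partial_nnsum P (D : seq V) : summableR P -> (forall x, 0 <= P x) ->
  uniq D -> \sum_(x <- D) P x <= nnsum P.
Proof. by move=> sP P0 uD; rewrite -lee_fin -esumEnnsum// le_partial_esum. Qed.

Lemma nnsum_le_bound P (c : R) : summableR P -> (forall x, 0 <= P x) ->
  (forall D : seq V, uniq D -> \sum_(x <- D) P x <= c) -> nnsum P <= c.
Proof.
by move=> sP P0 Pc; rewrite -lee_fin -esumEnnsum// esum_le_bound.
Qed.

Lemma nnsum_ge0 P : (forall x, 0 <= P x) -> 0 <= nnsum P.
Proof. by move=> P0; apply/fine_ge0/esum_ge0 => x _; rewrite lee_fin. Qed.

Lemma nnsumD P Q : summableR P -> summableR Q ->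
  (forall x, 0 <= P x) -> (forall x, 0 <= Q x) ->
  nnsum (fun x => P x + Q x) = nnsum P + nnsum Q.
Proof.
move=> sP sQ P0 Q0; apply: EFin_inj; rewrite EFinD -!esumEnnsum//; last 2 first.
- exact: summableRD.
- by move=> x; rewrite addr_ge0.
by rewrite -esumD// => x _; rewrite lee_fin.
Qed.

Lemma nnsumZ (a : R) P : 0 < a -> summableR P -> (forall x, 0 <= P x) ->
  nnsum (fun x => a * P x) = a * nnsum P.
Proof.
move=> a0 sP P0.
have aP0 x : 0 <= a * P x by rewrite mulr_ge0// ltW.
have saP := summableRZ a sP.
apply/eqP; rewrite eq_le -[X in _ && X]ler_pdivlMl//; apply/andP; split.
  apply: nnsum_le_bound => // D uD.
  by rewrite -mulr_sumr ler_pM2l// le_partial_nnsum.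
apply: nnsum_le_bound => // D uD.
by rewrite ler_pdivlMl// mulr_sumr le_partial_nnsum.
Qed.

Lemma rsumB P Q : summableR P -> summableR Q ->
  (forall x, 0 <= P x) -> (forall x, 0 <= Q x) ->
  rsum (fun x => P x - Q x) = nnsum P - nnsum Q.
Proof.
move=> sP sQ P0 Q0.
have sPQ : summableR (fun x => P x - Q x) by exact: (summableB sP sQ).
have := esumB sP sQ (fun x _ => P0 x) (fun x _ => Q0 x).
move/(congr1 fine); rewrite [X in _ = fine (X - _)%E]esumEnnsum//.
rewrite [X in _ = fine (_ - X)%E]esumEnnsum// -EFinB [X in _ = X]/= => <-.
rewrite /rsum fineB//.
  have := summable_funepos sPQ; rewrite summableE.
  by under eq_esum => x _ do rewrite gee0_abs//.
have := summable_funeneg sPQ; rewrite summableE.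
by under eq_esum => x _ do rewrite gee0_abs//.
Qed.

(** By [rsumB], any way of writing [F] as a difference of summable nonnegative
    families computes [rsum F]. In the decomposition [F = (|F| + F) - |F|] both
    terms are evidently summable. *)
Lemma rsum_nnsum F : summableR F ->
  rsum F = nnsum (fun x => `|F x| + F x) - nnsum (fun x => `|F x|).
Proof.
move=> sF; rewrite -rsumB//.
- by congr rsum; apply/funext => x; ring.
- exact/summableRD/sF/summableR_norm.
- exact: summableR_norm.
- by move=> x; rewrite -lerBlDr sub0r -normrN ler_norm.
Qed.

Lemma rsumN F : summableR F -> rsum (fun x => - F x) = - rsum F.
Proof.
move=> sF; rewrite (rsum_nnsum sF) opprB -rsumB//.
- by congr rsum; apply/funext => x; ring.
- exact: summableR_norm.
- exact/summableRD/sF/summableR_norm.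
- by move=> x; rewrite -lerBlDr sub0r -normrN ler_norm.
Qed.

Lemma rsumD F G : summableR F -> summableR G ->
  rsum (fun x => F x + G x) = rsum F + rsum G.
Proof.
have nn F' x : 0 <= `|F' x| + F' x by rewrite -lerBlDr sub0r -normrN ler_norm.
have sn F' : summableR F' -> summableR (fun x => `|F' x| + F' x).
  by move=> sF'; exact/summableRD/sF'/summableR_norm.
move=> sF sG.
rewrite (rsum_nnsum sF) (rsum_nnsum sG) addrACA -opprD.
rewrite -!nnsumD ?sn//; try exact: summableR_norm.
rewrite -rsumB.
- by congr rsum; apply/funext => x; ring.
- by apply: summableRD; exact: sn.
- by apply: summableRD; exact: summableR_norm.
- by move=> x; rewrite addr_ge0.
- by move=> x; rewrite addr_ge0.
Qed.

Lemma rsumZ (a : R) F : summableR F -> rsum (fun x => a * F x) = a * rsum F.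
Proof.
have nn F' x : 0 <= `|F' x| + F' x by rewrite -lerBlDr sub0r -normrN ler_norm.
have sn F' : summableR F' -> summableR (fun x => `|F' x| + F' x).
  by move=> sF'; exact/summableRD/sF'/summableR_norm.
have pos c : 0 < c -> summableR F -> rsum (fun x => c * F x) = c * rsum F.
  move=> c0 sF; rewrite rsum_nnsum ?summableRZ// (rsum_nnsum sF) mulrBr.
  rewrite -!nnsumZ ?sn//; try exact: summableR_norm.
  have cF x : `|c * F x| = c * `|F x| by rewrite normrM gtr0_norm.
  by congr (nnsum _ - nnsum _); apply/funext => x; rewrite cF// mulrDr.
move=> sF; have [a0|a0|->] := ltgtP a 0; [|exact: pos|]; last first.
  rewrite mul0r.
  have z x : 0 * F x = F x - F x by rewrite mul0r subrr.
  under eq_fun do rewrite z.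
  rewrite (rsumD sF); first by rewrite rsumN// subrr.
  by apply: (le_summableR sF) => x; rewrite normrN.
have E x : a * F x = - ((- a) * F x) by rewrite mulNr opprK.
under eq_fun do rewrite E.
rewrite rsumN; last exact: summableRZ.
by rewrite pos ?oppr_gt0// mulNr opprK.
Qed.

Lemma rsum_ge0E P : (forall x, 0 <= P x) -> summableR P -> rsum P = nnsum P.
Proof.
move=> P0 sP.
have s0 : summableR (fun=> 0) by apply: (le_summableR sP) => x; rewrite normr0.
have -> : rsum P = rsum (fun x => P x - 0).
  by congr rsum; apply/funext => x; rewrite subr0.
rewrite rsumB//.
by rewrite [X in _ - X]/nnsum esum1//= subr0.
Qed.

Lemma rsum_fin (D : seq V) F : uniq D -> (forall x, x \notin D -> F x = 0) ->
  rsum F = \sum_(x <- D) F x.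
Proof.
have E P : (forall x, 0 <= P x) -> uniq D ->
    (forall x, x \notin D -> P x = 0) -> nnsum P = \sum_(x <- D) P x.
  move=> P0 uD PD; rewrite /nnsum.
  have -> : (\esum_(x in [set: V]) (P x)%:E = \esum_(x in [set` D]) (P x)%:E)%E.
    rewrite [RHS]esum_mkcond; apply: eq_esum => x _.
    by case: ifPn => //; rewrite mem_setE => /PD ->.
  rewrite (esum_fset (finite_seq D)); last by move=> x _; rewrite lee_fin.
  by rewrite -fsbig_seq// sumEFin.
move=> uD FD.
have sF : summableR F.
  apply: (@le_summableR _ (fun x => `|F x|)) => [|x]; last by rewrite normr_id.
  rewrite /summableR /summable.
  apply: (@bounded_summableR _ (\sum_(x <- D) `|F x|)) => // D' uD'.
  by apply: ler_sum_support => // x /FD ->; rewrite normr0.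
rewrite rsum_nnsum// !E//.
- by rewrite -sumrB; apply: eq_bigr => x _; rewrite addrAC subrr add0r.
- by move=> x /FD ->; rewrite normr0.
- by move=> x; rewrite -lerBlDr sub0r -normrN ler_norm.
- by move=> x /FD ->; rewrite normr0 addr0.
Qed.

End summable_sums.

(** * The Hilbert space l^2(V, m) *)

Section summable_complex_sums.
Context {R : realType} {V : countType}.
Implicit Types F G : V -> R[i].

Definition summableC F :=
  summableR (@complex.Re R \o F) /\ summableR (@complex.Im R \o F).

Lemma csumD F G : summableC F -> summableC G ->
  csum (fun x => F x + G x) = csum F + csum G.
Proof.
move=> [F1 F2] [G1 G2].
transitivity (Complex (rsum (@complex.Re R \o F) + rsum (@complex.Re R \o G))
                      (rsum (@complex.Im R \o F) + rsum (@complex.Im R \o G)));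
  last by [].
rewrite -!rsumD//; congr Complex; congr rsum; apply/funext => x /=.
  by case: (F x) (G x) => [? ?] [].
by case: (F x) (G x) => [? ?] [].
Qed.

Lemma csumZ a F : summableC F -> csum (fun x => a * F x) = a * csum F.
Proof.
case: a => a1 a2 [F1 F2].
set Re := @complex.Re R \o F; set Im := @complex.Im R \o F.
transitivity (Complex (a1 * rsum Re - a2 * rsum Im)
                      (a1 * rsum Im + a2 * rsum Re)); last by [].
have sN : summableR (fun x => - (a2 * Im x)).
  by apply: (le_summableR (summableRZ a2 F2)) => x; rewrite normrN.
rewrite -!rsumZ// -rsumN ?summableRZ// -!rsumD ?summableRZ//.
congr Complex; congr rsum; apply/funext => x; rewrite /Re /Im /=.
  by case: (F x).
by case: (F x).
Qed.

Lemma csumJ F : summableC F -> csum (fun x => conjc (F x)) = conjc (csum F).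
Proof.
move=> [F1 F2]; rewrite /csum /conjc -rsumN//.
by congr Complex; congr rsum; apply/funext => x /=; case: (F x).
Qed.

End summable_complex_sums.

Section ell2_hilbert.
Context {R : realType} {V : countType}.
Variable m : V -> R.
Hypothesis m_gt0 : forall x, 0 < m x.
Implicit Types f g h : ell2 m.
Local Notation dot := (ell2_dot m).
Local Notation nrm := (hnorm (ell2_dot m)).
Local Notation sqn z := (Normc.normc z ^+ 2).

Lemma sqr_normcE (z : R[i]) : sqn z = complex.Re z ^+ 2 + complex.Im z ^+ 2.
Proof. by case: z => x y; rewrite sqr_sqrtr// addr_ge0 ?sqr_ge0. Qed.

Lemma weight_ge0 (f : V -> R[i]) x : 0 <= m x * sqn (f x).
Proof. by rewrite mulr_ge0 ?sqr_ge0// ltW. Qed.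

Lemma ell2_summable f : summableR (fun x => m x * sqn (f x)).
Proof. by case: f => f /= /asboolP. Qed.

(** Termwise, [|f g^*| <= |f|^2 + |g|^2]. *)
Lemma ell2_dot_summable f g :
  summableR (fun x => complex.Re ((m x)%:C%C * (f x * conjc (g x)))) /\
  summableR (fun x => complex.Im ((m x)%:C%C * (f x * conjc (g x)))).
Proof.
have sfg := summableRD (ell2_summable f) (ell2_summable g).
have mx x (a b : R) : `|a| <= b -> `|m x * a| <= m x * b.
  by move=> ab; rewrite normrM gtr0_norm// ler_wpM2l// ltW.
have key x : `|complex.Re ((m x)%:C%C * (f x * conjc (g x)))| <=
               `|m x * sqn (f x) + m x * sqn (g x)| /\
             `|complex.Im ((m x)%:C%C * (f x * conjc (g x)))| <=
               `|m x * sqn (f x) + m x * sqn (g x)|.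
  rewrite -mulrDr [`|_ * (_ + _)|]ger0_norm; last first.
    by rewrite mulr_ge0 ?addr_ge0 ?sqr_ge0// ltW.
  rewrite !sqr_normcE; case: (f x) (g x) => [a b] [c d] /=.
  rewrite !mul0r subr0 addr0; split; apply: mx; rewrite ler_norml.
    have := sqr_ge0 (a + c); have := sqr_ge0 (a - c).
    have := sqr_ge0 (b + d); have := sqr_ge0 (b - d).
    have := sqr_ge0 a; have := sqr_ge0 b; have := sqr_ge0 c; have := sqr_ge0 d.
    by move=> *; apply/andP; split; lra.
  have := sqr_ge0 (b + c); have := sqr_ge0 (b - c).
  have := sqr_ge0 (a + d); have := sqr_ge0 (a - d).
  have := sqr_ge0 a; have := sqr_ge0 b; have := sqr_ge0 c; have := sqr_ge0 d.
  by move=> *; apply/andP; split; lra.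
by split; apply: (le_summableR sfg) => x; case: (key x).
Qed.

Lemma Re_weighted_sqr (f : V -> R[i]) x :
  complex.Re ((m x)%:C%C * (f x * conjc (f x))) = m x * sqn (f x).
Proof. by rewrite sqr_normcE; case: (f x) => a b /=; ring. Qed.

Lemma Re_ell2_dot_self f :
  complex.Re (dot f f) = nnsum (fun x => m x * sqn (f x)).
Proof.
rewrite /= -rsum_ge0E; last exact: ell2_summable.
  by congr rsum; apply/funext => x; exact: Re_weighted_sqr.
by move=> x; exact: weight_ge0.
Qed.

Lemma ell2_le_partial f (D : seq V) : uniq D ->
  \sum_(x <- D) m x * sqn (f x) <= complex.Re (dot f f).
Proof.
move=> uD; rewrite Re_ell2_dot_self le_partial_nnsum//.
  exact: ell2_summable.
by move=> x; exact: weight_ge0.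
Qed.

Lemma ell2_dotP : hermitian_product dot.
Proof.
split.
- move=> f g h; rewrite -csumD; [|exact: ell2_dot_summable..].
  congr csum; apply/funext => x.
  by rewrite -[(f + g) x]/(f x + g x) mulrDl mulrDr.
- move=> a f g; rewrite -csumZ; last exact: ell2_dot_summable.
  congr csum; apply/funext => x.
  by rewrite -[(a *: f) x]/(a * f x) -mulrA mulrCA.
- move=> f g; rewrite -csumJ; last exact: ell2_dot_summable.
  congr csum; apply/funext => x.
  by case: (f x) (g x) => [? ?] [? ?] /=; congr Complex; ring.
- move=> f; rewrite Re_ell2_dot_self nnsum_ge0// => x; exact: weight_ge0.
- move=> f f0; apply/val_inj/funext => x.
  have := @ell2_le_partial f [:: x] isT; rewrite big_seq1 f0 pmulr_rle0//.
  move=> fx; apply: Normc.eq0_normc; apply/eqP.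
  by rewrite -sqrf_eq0 eq_le fx sqr_ge0.
Qed.

Lemma sqr_hnorm_ell2 f : nrm f ^+ 2 = nnsum (fun x => m x * sqn (f x)).
Proof. by rewrite (sqr_hnorm ell2_dotP) Re_ell2_dot_self. Qed.

Lemma ell2_hnorm_le f (c : R) : 0 <= c ->
  (forall D : seq V, uniq D -> \sum_(x <- D) m x * sqn (f x) <= c ^+ 2) ->
  nrm f <= c.
Proof.
move=> c0 fc; rewrite -(@ler_pXn2r _ 2)// ?nnegrE ?hnorm_ge0//.
rewrite sqr_hnorm_ell2; apply: nnsum_le_bound => //; first exact: ell2_summable.
by move=> x; exact: weight_ge0.
Qed.

Lemma normcB_sqrE (z w : R[i]) : sqn (z - w) =
  (complex.Re z - complex.Re w) ^+ 2 + (complex.Im z - complex.Im w) ^+ 2.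
Proof. by rewrite sqr_normcE; case: z w => [? ?] []. Qed.

(** A single term of the series for the norm bounds the value at [x]. *)
Lemma ell2_Re_Im_le f x :
  `|complex.Re (f x)| <= nrm f / Num.sqrt (m x) /\
  `|complex.Im (f x)| <= nrm f / Num.sqrt (m x).
Proof.
have sm : 0 < Num.sqrt (m x) by rewrite sqrtr_gt0.
have := @ell2_le_partial f [:: x] isT.
rewrite big_seq1 -(sqr_hnorm ell2_dotP) sqr_normcE => H.
have key (a c : R) : m x * (a ^+ 2 + c ^+ 2) <= nrm f ^+ 2 ->
    `|a| <= nrm f / Num.sqrt (m x).
  move=> H1; rewrite ler_pdivlMr//.
  rewrite -(@ler_pXn2r _ 2)// ?nnegrE ?mulr_ge0 ?hnorm_ge0 ?(ltW sm)//.
  rewrite exprMn sqr_sqrtr ?(ltW (m_gt0 x))// real_normK ?num_real//.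
  apply: le_trans H1.
  by rewrite mulrC ler_wpM2l ?(ltW (m_gt0 x))// lerDl sqr_ge0.
split; first exact: (key _ _ H).
by apply: (key _ (complex.Re (f x))); rewrite [_ ^+ 2 + _]addrC.
Qed.

Lemma ell2_cvg_pointwise (u : nat -> ell2 m) f x :
  nrm (u n - f) @[n --> \oo] --> (0 : R) ->
  complex.Re (u n x) @[n --> \oo] --> complex.Re (f x) /\
  complex.Im (u n x) @[n --> \oo] --> complex.Im (f x).
Proof.
move=> uf.
have uf0 : nrm (u n - f) / Num.sqrt (m x) @[n --> \oo] --> (0 : R).
  by rewrite -[X in _ --> X](mul0r (Num.sqrt (m x))^-1); apply: cvgMl.
split; apply/subr_cvg0; apply: norm_cvg0; apply: squeeze_cvg0 uf0 => n.
  rewrite normr_ge0/=; have [] := ell2_Re_Im_le (u n - f) x.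
  have -> : (u n - f) x = u n x - f x by [].
  by case: (u n x) (f x) => [? ?] [].
rewrite normr_ge0/=; have [_] := ell2_Re_Im_le (u n - f) x.
have -> : (u n - f) x = u n x - f x by [].
by case: (u n x) (f x) => [? ?] [].
Qed.

(** A Cauchy sequence converges pointwise, and the bound on the finite partial
    sums of [m |u n - u p|^2] survives the limit in [p]; this shows both that
    the pointwise limit is square summable and that the convergence holds in
    norm. *)
Lemma ell2_complete : hcomplete dot.
Proof.
move=> u uC.
have Rc (v : nat -> R) (c : R) :
    (forall n p, `|v n - v p| <= nrm (u n - u p) / c) ->
    0 < c -> cvg (v @ \oo).
  move=> vu c0; apply: cauchy_cvg; apply: cauchy_exP => e /= e0.
  have e2 : 0 < c * e / 2 by rewrite !mulr_gt0.
  have [N NP] := uC _ e2; exists (v N); exists N => // n /= Nn.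
  rewrite /ball/=; apply: le_lt_trans (vu _ _) _; rewrite ltr_pdivrMr//.
  by have := NP _ _ (leqnn N) Nn; have := mulr_gt0 c0 e0; lra.
have sm x : 0 < Num.sqrt (m x) by rewrite sqrtr_gt0.
have cRe x : cvg (complex.Re (u n x) @[n --> \oo]).
  apply: Rc (sm x) => n p; have [] := ell2_Re_Im_le (u n - u p) x.
  have -> : (u n - u p) x = u n x - u p x by [].
  by case: (u n x) (u p x) => [? ?] [].
have cIm x : cvg (complex.Im (u n x) @[n --> \oo]).
  apply: Rc (sm x) => n p; have [_] := ell2_Re_Im_le (u n - u p) x.
  have -> : (u n - u p) x = u n x - u p x by [].
  by case: (u n x) (u p x) => [? ?] [].
pose l x : R[i] := Complex (lim (complex.Re (u n x) @[n --> \oo]))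
                           (lim (complex.Im (u n x) @[n --> \oo])).
have ul (e : R) : 0 < e -> exists N, forall n, (N <= n)%N ->
    forall D : seq V, uniq D -> \sum_(x <- D) m x * sqn (u n x - l x) <= e ^+ 2.
  move=> e0; have [N NP] := uC _ e0; exists N => n Nn D uD.
  have cx x : m x * sqn (u n x - u p x) @[p --> \oo] -->
              m x * sqn (u n x - l x).
    apply: cvgMr; rewrite normcB_sqrE; under eq_fun do rewrite normcB_sqrE.
    apply: cvgD; rewrite expr2; under eq_fun do rewrite expr2.
      by apply: cvgM; (apply: cvgB; [exact: cvg_cst|exact: cRe]).
    by apply: cvgM; (apply: cvgB; [exact: cvg_cst|exact: cIm]).
  have cD : \sum_(x <- D) m x * sqn (u n x - u p x) @[p --> \oo] -->
            \sum_(x <- D) m x * sqn (u n x - l x).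
    by apply: cvg_big => [|x _]; [exact: add_continuous|exact: cx].
  apply: (cvgr_to_le cD); near=> p.
  apply: le_trans (@ell2_le_partial (u n - u p) D uD) _.
  rewrite -(sqr_hnorm ell2_dotP) ler_pXn2r ?nnegrE ?hnorm_ge0 ?(ltW e0)//.
  by apply: NP => //; near: p; exists N.
have [N1 N1P] := ul _ (@ltr01 R).
(* The limit is u N1 minus an element of the space. *)
have unl : (fun x => u N1 x - l x) \in ell2_pred m.
  apply/asboolP; apply: (@bounded_summableR _ _ _ (1 ^+ 2)).
    by move=> x; exact: (weight_ge0 (fun x => u N1 x - l x)).
  exact: N1P.
have Pl : l \in ell2_pred m.
  have := valP (u N1 - Ell2 unl).
  have -> // : \val (u N1 - Ell2 unl) = l.
  by apply/funext => x /=; rewrite -[LHS]/(u N1 x - (u N1 x - l x)) subKr.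
exists (Ell2 Pl).
apply/cvgrPdist_le => e e0.
have [N NP] := ul _ e0.
exists N => // n /= Nn; rewrite sub0r normrN ger0_norm ?hnorm_ge0//.
by apply: ell2_hnorm_le => [|D uD]; [exact: ltW|exact: NP].
Unshelve. all: by end_near. Qed.

End ell2_hilbert.

(** * Energy identity for balanced weights *)

Section energy.
Context {R : realFieldType} {V : eqType}.
Variables (D : seq V) (c : V -> V -> R) (s : V -> R).
Hypothesis c_balanced : forall x, s x != 0 ->
  \sum_(y <- D) c x y = \sum_(y <- D) c y x.

(** Since [c] has equal row and column sums on the support of [s], the sums of
    [c x y (s x v x)^2] and [c x y (s y v y)^2] agree, which completes the
    square. *)
Lemma balanced_energy (v : V -> R) :
  \sum_(x <- D) \sum_(y <- D)
     c x y * ((s x ^+ 2 * v x - s y ^+ 2 * v y) * v x) =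
  2^-1 * (\sum_(x <- D) \sum_(y <- D) c x y * (s x * v x - s y * v y) ^+ 2) +
  \sum_(x <- D) \sum_(y <- D) c x y * (s y * (s x - s y) * (v x * v y)).
Proof.
have bal : \sum_(x <- D) \sum_(y <- D) c x y * (s x * v x) ^+ 2 =
           \sum_(x <- D) \sum_(y <- D) c x y * (s y * v y) ^+ 2.
  rewrite [RHS]exchange_big/=; apply: eq_bigr => x _.
  rewrite -!mulr_suml; have [->|sx] := eqVneq (s x) 0.
    by rewrite mul0r expr0n !mulr0.
  by rewrite c_balanced.
have -> : \sum_(x <- D) \sum_(y <- D)
     c x y * ((s x ^+ 2 * v x - s y ^+ 2 * v y) * v x) =
  2^-1 * (\sum_(x <- D) \sum_(y <- D) c x y * (s x * v x) ^+ 2 +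
          \sum_(x <- D) \sum_(y <- D) c x y * (s x * v x) ^+ 2) -
  \sum_(x <- D) \sum_(y <- D) c x y * (s y ^+ 2 * v y * v x).
  have half (a : R) : 2^-1 * (a + a) = a by field.
  rewrite half -sumrB.
  apply: eq_bigr => x _; rewrite -sumrB; apply: eq_bigr => y _; ring.
rewrite [X in _ * (_ + X)]bal.
rewrite -big_split/= !mulr_sumr -sumrB -big_split/=; apply: eq_bigr => x _.
rewrite -big_split/= !mulr_sumr -sumrB -big_split/=; apply: eq_bigr => y _.
by field.
Qed.

(** The symmetric weight that the cutoff [s] puts on the edge [x, y] in the
    error term of [balanced_energy_ge]. *)
Definition cutoff_cost x y := (c x y + c y x) / 2 * (s x - s y) ^+ 2 +
  `|c x y - c y x| * `|s x - s y|.

Hypothesis c_ge0 : forall x y, 0 <= c x y.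
Hypothesis s01 : forall x, 0 <= s x <= 1.

Lemma cutoff_cost_ge0 x y : 0 <= cutoff_cost x y.
Proof.
apply: addr_ge0; last exact: mulr_ge0.
by apply: mulr_ge0; [apply: divr_ge0; [exact: addr_ge0|]|exact: sqr_ge0].
Qed.

Lemma cutoff_costC x y : cutoff_cost x y = cutoff_cost y x.
Proof.
by rewrite /cutoff_cost (distrC (c x y)) (distrC (s x)); congr (_ + _); ring.
Qed.

(** The cross term of [balanced_energy] is symmetrized in [x] and [y]; its
    coefficient becomes [(s x - s y) (c x y s y - c y x s x)], which splits into
    a symmetric part of order [(s x - s y)^2] and an antisymmetric part of order
    [s x - s y]. The product [v x v y] is then distributed on the two
    endpoints. *)
Lemma balanced_energy_ge (v : V -> R) :
  - (2^-1 * \sum_(x <- D) v x ^+ 2 * \sum_(y <- D) cutoff_cost x y) <=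
  \sum_(x <- D) \sum_(y <- D)
     c x y * ((s x ^+ 2 * v x - s y ^+ 2 * v y) * v x).
Proof.
rewrite balanced_energy.
set E := (X in 2^-1 * X + _); set T := (X in _ + X).
have E0 : 0 <= E.
  by apply: sumr_ge0 => x _; apply: sumr_ge0 => y _; rewrite mulr_ge0// sqr_ge0.
have T2 : T + T = \sum_(x <- D) \sum_(y <- D)
    ((s x - s y) * (c x y * s y - c y x * s x) * (v x * v y)).
  rewrite {2}/T exchange_big/= /T -big_split; apply: eq_bigr => x _ /=.
  by rewrite -big_split; apply: eq_bigr => y _ /=; ring.
have K2 : \sum_(x <- D) v x ^+ 2 * (\sum_(y <- D) cutoff_cost x y) =
   \sum_(x <- D) \sum_(y <- D) cutoff_cost x y * ((v x ^+ 2 + v y ^+ 2) / 2).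
  have -> : \sum_(x <- D) v x ^+ 2 * (\sum_(y <- D) cutoff_cost x y) =
    2^-1 * (\sum_(x <- D) \sum_(y <- D) cutoff_cost x y * v x ^+ 2) +
    2^-1 * (\sum_(x <- D) \sum_(y <- D) cutoff_cost x y * v y ^+ 2).
    rewrite [X in _ = _ + _ * X]exchange_big/= -mulrDr -big_split/= mulr_sumr.
    apply: eq_bigr => x _; rewrite -mulr_suml -[X in _ = _ * (_ + X)]mulr_suml.
    have -> : \sum_(i <- D) cutoff_cost i x = \sum_(i <- D) cutoff_cost x i.
      by apply: eq_bigr => y _; rewrite cutoff_costC.
    by field.
  rewrite -mulrDr -big_split/= mulr_sumr; apply: eq_bigr => x _.
  by rewrite -big_split/= mulr_sumr; apply: eq_bigr => y _; field.
have KT : - (\sum_(x <- D) v x ^+ 2 * (\sum_(y <- D) cutoff_cost x y)) <= T + T.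
  rewrite K2 T2 -sumrN; apply: ler_sum => x _.
  rewrite -sumrN; apply: ler_sum => y _.
  have vv : `|v x * v y| <= (v x ^+ 2 + v y ^+ 2) / 2.
    rewrite ler_norml; have := sqr_ge0 (v x - v y); have := sqr_ge0 (v x + v y).
    by move=> *; apply/andP; split; lra.
  have kk : `|(s x - s y) * (c x y * s y - c y x * s x)| <= cutoff_cost x y.
    have -> : (s x - s y) * (c x y * s y - c y x * s x) =
      - ((c x y + c y x) / 2 * (s x - s y) ^+ 2) +
      (c x y - c y x) * (s x - s y) * ((s x + s y) / 2) by field.
    apply: le_trans (ler_normD _ _) _; rewrite normrN.
    rewrite [X in X + _]ger0_norm; last first.
      by rewrite mulr_ge0 ?sqr_ge0// divr_ge0// addr_ge0.
    rewrite lerD2l 2!normrM ler_piMr ?mulr_ge0//.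
    have := s01 x; have := s01 y => /andP[y0 y1] /andP[x0 x1].
    by rewrite ger0_norm; lra.
  rewrite lerNl; apply: le_trans (ler_norm _) _; rewrite normrN normrM.
  by apply: ler_pM.
by lra.
Qed.

End energy.

(** * The Laplacian on finitely supported functions *)

Section directed_graph_laplacian.
Context {R : realType} {V : countType}.
Variables (b : V -> V -> R) (m : V -> R).
Hypothesis b_ge0 : forall x y, 0 <= b x y.
Hypothesis m_gt0 : forall x, 0 < m x.
Hypothesis b_lf : locally_finite b.
Local Notation sqn z := (Normc.normc z ^+ 2).

Local Notation adj := (Defs.adjacent b).

Definition nbhd x : seq V := finmap.enum_fset (fset_set (neighbours b x)).

Lemma nbhd_uniq x : uniq (nbhd x). Proof. exact: finmap.fset_uniq. Qed.

Lemma mem_nbhd x y : (y \in nbhd x) = adj x y.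
Proof.
by apply/idP/idP; rewrite /nbhd in_fset_set// inE.
Qed.

Lemma adjacentC x y : adj x y = adj y x.
Proof. by rewrite /Defs.adjacent orbC. Qed.

Lemma nadjacent0 x y : ~~ adj x y -> b x y = 0 /\ b y x = 0.
Proof.
by rewrite negb_or -!leNgt => /andP[h1 h2]; split; apply/eqP;
  rewrite eq_le ?h1 ?h2 b_ge0.
Qed.

Lemma fsbig_nbhd (F : V -> R) x :
  \sum_(y \in neighbours b x) F y = \sum_(y <- nbhd x) F y.
Proof. by rewrite fsbig_finite. Qed.

Lemma fsbigT_seq (M : nmodType) (D : seq V) (F : V -> M) : uniq D ->
  (forall y, y \notin D -> F y = 0) ->
  \sum_(y \in [set: V]) F y = \sum_(y <- D) F y.
Proof.
move=> uD FD; rewrite (fsbigE D)//; last by move=> y _; exact: FD.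
by apply: eq_bigl => y; rewrite in_setT.
Qed.

Lemma Re_realM (a : R) (z : R[i]) :
  complex.Re (a%:C%C * z) = a * complex.Re z.
Proof. by case: z => ? ? /=; rewrite mul0r subr0. Qed.

Lemma Im_realM (a : R) (z : R[i]) :
  complex.Im (a%:C%C * z) = a * complex.Im z.
Proof. by case: z => ? ? /=; rewrite mul0r addr0. Qed.

Lemma Re_sum (I : Type) (r : seq I) (F : I -> R[i]) :
  complex.Re (\sum_(i <- r) F i) = \sum_(i <- r) complex.Re (F i).
Proof. by apply: (big_morph _ _ _) => // [[? ?] []]. Qed.

Lemma Im_sum (I : Type) (r : seq I) (F : I -> R[i]) :
  complex.Im (\sum_(i <- r) F i) = \sum_(i <- r) complex.Im (F i).
Proof. by apply: (big_morph _ _ _) => // [[? ?] []]. Qed.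

Lemma formal_laplacian_seq (D : seq V) (f : V -> R[i]) x : uniq D ->
  (forall y, y \notin D -> b x y = 0 \/ f x = f y) ->
  formal_laplacian b m f x =
  ((m x)^-1)%:C%C * \sum_(y <- D) (b x y)%:C%C * (f x - f y).
Proof.
move=> uD xD; congr (_ * _); apply: fsbigT_seq => // y /xD[->|->].
  by rewrite mul0r.
by rewrite subrr mulr0.
Qed.

Lemma Re_formal_laplacian (D : seq V) (f : V -> R[i]) x : uniq D ->
  (forall y, y \notin D -> b x y = 0 \/ f x = f y) ->
  complex.Re (formal_laplacian b m f x) =
  (m x)^-1 * \sum_(y <- D) b x y * (complex.Re (f x) - complex.Re (f y)).
Proof.
move=> uD xD; rewrite (formal_laplacian_seq uD xD).
rewrite Re_realM Re_sum; congr (_ * _); apply: eq_bigr => y _; rewrite Re_realM.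
by case: (f x) (f y) => [? ?] [].
Qed.

Lemma Im_formal_laplacian (D : seq V) (f : V -> R[i]) x : uniq D ->
  (forall y, y \notin D -> b x y = 0 \/ f x = f y) ->
  complex.Im (formal_laplacian b m f x) =
  (m x)^-1 * \sum_(y <- D) b x y * (complex.Im (f x) - complex.Im (f y)).
Proof.
move=> uD xD; rewrite (formal_laplacian_seq uD xD).
rewrite Im_realM Im_sum; congr (_ * _); apply: eq_bigr => y _; rewrite Im_realM.
by case: (f x) (f y) => [? ?] [].
Qed.

Lemma nbhdP (f : V -> R[i]) x y : y \notin nbhd x -> b x y = 0 \/ f x = f y.
Proof. by rewrite mem_nbhd => /nadjacent0[]; left. Qed.

(** Norm convergence implies pointwise convergence, and [formal_laplacian] at a
    vertex depends continuously on the finitely many values around it. In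
    particular the Laplacian is closable. *)
Lemma op_closure_laplacian_formal f g :
  op_closure (ell2_dot m) (laplacian b m) (f, g) ->
  (g : V -> R[i]) = formal_laplacian b m f.
Proof.
move=> [u [uA u1 u2]]; apply/funext => x.
have [g1 g2] := ell2_cvg_pointwise m_gt0 x u2.
have c1 y := (ell2_cvg_pointwise m_gt0 y u1).1.
have c2 y := (ell2_cvg_pointwise m_gt0 y u1).2.
apply/eqP; rewrite eq_complex; apply/andP; split; apply/eqP.
  rewrite (Re_formal_laplacian (nbhd_uniq x) (@nbhdP f x)).
  rewrite -(cvg_lim (@Rhausdorff R) g1); apply/cvg_lim; first exact: Rhausdorff.
  under eq_fun do rewrite (uA _).2
    (Re_formal_laplacian (nbhd_uniq x) (@nbhdP (u _).1 x)).
  apply: cvgMr; apply: cvg_big => [|y _]; first exact: add_continuous.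
  by apply: cvgMr; apply: cvgB; exact: c1.
rewrite (Im_formal_laplacian (nbhd_uniq x) (@nbhdP f x)).
rewrite -(cvg_lim (@Rhausdorff R) g2); apply/cvg_lim; first exact: Rhausdorff.
under eq_fun do rewrite (uA _).2
  (Im_formal_laplacian (nbhd_uniq x) (@nbhdP (u _).1 x)).
apply: cvgMr; apply: cvg_big => [|y _]; first exact: add_continuous.
by apply: cvgMr; apply: cvgB; exact: c2.
Qed.

Lemma laplacian_operator : is_operator (laplacian b m).
Proof.
have lin a (f g : V -> R[i]) x :
    formal_laplacian b m (fun x => a * f x + g x) x =
    a * formal_laplacian b m f x + formal_laplacian b m g x.
  rewrite !(formal_laplacian_seq (nbhd_uniq x) (@nbhdP _ x)).
  rewrite mulrCA -mulrDr; congr (_ * _); rewrite mulr_sumr -big_split/=.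
  by apply: eq_bigr => y _; ring.
split.
- split=> /=.
    rewrite /Cc/= (_ : [set _ | _] = set0)//.
    by apply/seteqP; split=> x //= /eqP.
  apply/funext => x; rewrite (formal_laplacian_seq (nbhd_uniq x) (@nbhdP _ x)).
  by rewrite big1 ?mulr0// => y _; rewrite subrr mulr0.
- move=> a [f1 f2] [g1 g2] [/= Cf Ef] [/= Cg Eg]; split=> /=.
    apply: (@sub_finite_set _ _ ([set x | f1 x != 0] `|` [set x | g1 x != 0])).
      move=> x /=; rewrite -[(_ + _) x]/(a * f1 x + g1 x).
      have [->|] := eqVneq (f1 x) 0; last by left.
      by rewrite mulr0 add0r; right.
    by rewrite finite_setU.
  apply/funext => x; rewrite -[LHS]/(a * f2 x + g2 x) Ef Eg.
  by rewrite -(lin a f1 g1 x).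
- move=> f g h [/= _ Eg] [/= _ Eh]; apply/val_inj.
  by rewrite /= Eg Eh.
Qed.

(** The condition under which the sums over [V] in [<Delta f, v>] may be
    replaced by sums over the list [D] for both indices. *)
Definition absorbs (D : seq V) (f : V -> R[i]) := forall x, f x != 0 ->
  x \in D /\ {subset nbhd x <= D}.

Lemma Cc_absorbs (f : V -> R[i]) : Cc f -> exists2 D, uniq D & absorbs D f.
Proof.
move=> /finite_seqP[L fL].
exists (undup (L ++ flatten [seq nbhd x | x <- L])); first exact: undup_uniq.
move=> x fx; have xL : x \in L.
  by have : [set` L] x by rewrite -fL.
split=> [|y yx]; rewrite mem_undup mem_cat ?xL//.
by apply/orP; right; apply/flatten_mapP; exists x.
Qed.

Lemma absorbs_laplacian (D : seq V) (f : V -> R[i]) x y : absorbs D f ->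
  x \notin D \/ y \notin D -> b x y = 0 \/ f x = f y.
Proof.
move=> Df xyD.
have [fx|fx] := eqVneq (f x) 0; have [fy|fy] := eqVneq (f y) 0.
- by right; rewrite fx fy.
- left; have [yD Ny] := Df _ fy; case: xyD; last by rewrite yD.
  by move=> xD; apply: (@nadjacent0 x y _).1; rewrite adjacentC -mem_nbhd;
    apply: contra xD; exact: Ny.
- left; have [xD Nx] := Df _ fx; case: xyD; first by rewrite xD.
  by move=> yD; apply: (@nadjacent0 x y _).1; rewrite -mem_nbhd;
    apply: contra yD; exact: Nx.
- have [xD _] := Df _ fx; have [yD _] := Df _ fy.
  by case: xyD => /negP.
Qed.

Lemma Re_mulJ (z w : R[i]) : complex.Re (z * conjc w) =
  complex.Re z * complex.Re w + complex.Im z * complex.Im w.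
Proof. by case: z w => [? ?] [? ?] /=; ring. Qed.

(** Splitting into real and imaginary parts reduces the complex form to two
    copies of the real form of [balanced_energy]. *)
Lemma laplacian_pairing (f g v : ell2 m) (D : seq V) : uniq D -> absorbs D f ->
  laplacian b m (f, g) ->
  complex.Re (ell2_dot m g v) =
  \sum_(x <- D) \sum_(y <- D)
    b x y * ((complex.Re (f x) - complex.Re (f y)) * complex.Re (v x)) +
  \sum_(x <- D) \sum_(y <- D)
    b x y * ((complex.Im (f x) - complex.Im (f y)) * complex.Im (v x)).
Proof.
move=> uD Df [/= _ gE].
have outD x y : x \notin D \/ y \notin D -> b x y = 0 \/ f x = f y.
  exact: absorbs_laplacian.
rewrite /= (rsum_fin uD); last first.
  move=> x xD; rewrite gE (@formal_laplacian_seq [::])//.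
    by rewrite big_nil mulr0 mul0r mulr0.
  by move=> y _; apply: outD; left.
rewrite -big_split/=; apply: eq_bigr => x _.
have xD y : y \notin D -> b x y = 0 \/ f x = f y.
  by move=> yD; apply: outD; right.
rewrite Re_realM Re_mulJ gE.
rewrite (Re_formal_laplacian uD xD) (Im_formal_laplacian uD xD).
rewrite mulrDr -!mulrA !mulVKf ?gt_eqF// !mulr_suml.
by congr (_ + _); apply: eq_bigr => y _; rewrite mulrA.
Qed.

Hypothesis b_kirchhoff : kirchhoff b.

Lemma kirchhoff_seq (D : seq V) x : uniq D -> {subset nbhd x <= D} ->
  \sum_(y <- D) b x y = \sum_(y <- D) b y x.
Proof.
move=> uD ND.
have out y : y \notin D -> b x y = 0 /\ b y x = 0.
  move=> yD; apply: nadjacent0; rewrite -mem_nbhd.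
  by apply: contra yD; exact: ND.
have := b_kirchhoff x; rewrite (fsbigT_seq uD) => [|y /out[]//].
by rewrite (fsbigT_seq uD) => [//|y /out[]].
Qed.

(** For [s] the indicator of the support of [f], the factor
    [s y (s x - s y) v x v y] of the cross term in [balanced_energy] vanishes,
    and a sum of squares remains. *)
Lemma laplacian_accretive : accretive (ell2_dot m) (laplacian b m).
Proof.
split=> [|f g fg]; first exact: laplacian_operator.
have [D uD Df] := Cc_absorbs fg.1.
pose s x : R := (f x != 0)%:R.
have bal x : s x != 0 -> \sum_(y <- D) b x y = \sum_(y <- D) b y x.
  rewrite /s; case: (eqVneq (f x) 0) => [|fx _]; first by rewrite eqxx.
  by apply: kirchhoff_seq => //; exact: (Df _ fx).2.
have en (v : V -> R) : (forall x, f x = 0 -> v x = 0) ->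
    0 <= \sum_(x <- D) \sum_(y <- D) b x y * ((v x - v y) * v x).
  move=> fv.
  have sv x : s x ^+ 2 * v x = v x.
    rewrite /s; case: (eqVneq (f x) 0) => [/fv ->|_]; first by rewrite mulr0.
    by rewrite expr1n mul1r.
  have -> : \sum_(x <- D) \sum_(y <- D) b x y * ((v x - v y) * v x) =
    \sum_(x <- D) \sum_(y <- D)
      b x y * ((s x ^+ 2 * v x - s y ^+ 2 * v y) * v x).
    by apply: eq_bigr => x _; apply: eq_bigr => y _; rewrite !sv.
  rewrite (balanced_energy bal) [X in _ + X]big1 ?addr0.
    rewrite mulr_ge0 ?invr_ge0//; apply: sumr_ge0 => x _.
    by apply: sumr_ge0 => y _; rewrite mulr_ge0 ?sqr_ge0.
  move=> x _; rewrite big1// => y _.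
  have [/fv ->|fx] := eqVneq (f x) 0; first by rewrite mul0r !mulr0.
  have [/fv ->|fy] := eqVneq (f y) 0; first by rewrite !mulr0.
  by rewrite /s fx fy subrr mulr0 mul0r mulr0.
rewrite (laplacian_pairing f uD Df fg).
by apply: addr_ge0; apply: en => x ->.
Qed.

End directed_graph_laplacian.

(** * Cutoff argument *)

Section cutoff_argument.
Context {R : realType} {V : countType}.
Variables (b : V -> V -> R) (m : V -> R).
Hypothesis b_ge0 : forall x y, 0 <= b x y.
Hypothesis m_gt0 : forall x, 0 < m x.
Hypothesis b_lf : locally_finite b.
Hypothesis b_kirchhoff : kirchhoff b.
Local Notation sqn z := (Normc.normc z ^+ 2).
Local Notation dot := (ell2_dot m).

Lemma ell2_tail (f : ell2 m) (e : R) : 0 < e ->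
  exists F : seq V, forall D, uniq D ->
    \sum_(x <- D | x \notin F) m x * sqn (f x) <= e.
Proof.
move=> e0; apply/not_existsP => H.
pose q x := m x * sqn (f x).
have q0 x : 0 <= q x by exact: weight_ge0.
have sq : summableR q by exact: ell2_summable.
suff : nnsum q <= nnsum q - e by lra.
apply: nnsum_le_bound => // F uF; rewrite lerBrDr.
apply: contrapT => nF; apply: (H F) => D uD.
apply: contrapT => nD; apply: nF.
apply: le_trans (_ : \sum_(x <- F) q x + \sum_(x <- D | x \notin F) q x <= _).
  by rewrite lerD2l; move/negP: nD; rewrite -ltNge => /ltW.
rewrite -[X in _ + X]big_filter -big_cat; apply: le_partial_nnsum => //.
rewrite cat_uniq uF filter_uniq// andbT.
by apply/hasPn => x; rewrite mem_filter => /andP[].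
Qed.

(** The test function is [s^2 r]: the term [z s^2 r] contributes
    [Re z |s r|^2] and the Laplacian contributes at least the negative of the
    error term of [balanced_energy_ge]. *)
Lemma cutoff_estimate (z : R[i]) (r : ell2 m) (s : V -> R) (D : seq V) :
  (forall p, laplacian b m p -> complex.Re (dot (p.2 + z *: p.1) r) = 0) ->
  Cc s -> (forall x, 0 <= s x <= 1) -> uniq D ->
  (forall x, s x != 0 -> x \in D /\ {subset nbhd b x <= D}) ->
  complex.Re z * (\sum_(x <- D) m x * (s x ^+ 2 * sqn (r x))) <=
  2^-1 * (\sum_(x <- D) sqn (r x) * \sum_(y <- D) cutoff_cost b s x y).
Proof.
move=> orth Cs s01 uD sD.
pose f x : R[i] := (s x ^+ 2)%:C%C * r x.
have fs x : f x != 0 -> s x != 0.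
  by apply: contra => /eqP sx; rewrite /f sx expr0n mul0r.
have Cf : Cc f by apply: sub_finite_set Cs => x /=; exact: fs.
have Cg := formal_laplacian_Cc m b_ge0 b_lf Cf.
pose F := Ell2 (Cc_ell2 m Cf); pose G := Ell2 (Cc_ell2 m Cg).
have FG : laplacian b m (F, G) by split.
have FD : absorbs b D F by move=> x /fs/sD.
have Ref x : complex.Re (f x) = s x ^+ 2 * complex.Re (r x).
  exact: Re_realM.
have Imf x : complex.Im (f x) = s x ^+ 2 * complex.Im (r x).
  exact: Im_realM.
have zF : complex.Re (dot (z *: F) r) =
    complex.Re z * (\sum_(x <- D) m x * (s x ^+ 2 * sqn (r x))).
  rewrite /= (rsum_fin uD).
    rewrite mulr_sumr; apply: eq_bigr => x _.
    rewrite -[(z *: f) x]/(z * f x) /f sqr_normcE.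
    by move: (z) (r x) => [? ?] [? ?] /=; ring.
  move=> x xD; rewrite -[(z *: f) x]/(z * f x).
  have [->|/fs/sD[]] := eqVneq (f x) 0; first by rewrite mulr0 mul0r mulr0.
  by rewrite (negPf xD).
have := orth _ FG; rewrite (rdotDl (ell2_dotP m_gt0)) zF.
rewrite (laplacian_pairing b_ge0 m_gt0 b_lf r uD FD FG).
have bal x : s x != 0 -> \sum_(y <- D) b x y = \sum_(y <- D) b y x.
  by move=> /sD[_ ND]; exact: kirchhoff_seq ND.
have eRe := balanced_energy_ge bal b_ge0 s01 (fun x => complex.Re (r x)).
have eIm := balanced_energy_ge bal b_ge0 s01 (fun x => complex.Im (r x)).
rewrite /= in eRe eIm *.
under eq_bigr do under eq_bigr do rewrite !Ref.
under [X in _ + X + _]eq_bigr do under eq_bigr do rewrite !Imf.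
under [X in _ -> _ <= _ * X]eq_bigr do rewrite sqr_normcE mulrDl.
rewrite big_split/= mulrDr; lra.
Qed.

End cutoff_argument.

Section chi_completeness.
Context {R : realType} {V : countType}.
Variables (b : V -> V -> R) (m : V -> R).
Hypothesis b_ge0 : forall x y, 0 <= b x y.
Hypothesis m_gt0 : forall x, 0 < m x.
Hypothesis b_lf : locally_finite b.
Hypothesis b_kirchhoff : kirchhoff b.
Local Notation sqn z := (Normc.normc z ^+ 2).
Local Notation dot := (ell2_dot m).

Lemma cutoff_cost_row (s : V -> R) (D : seq V) x : uniq D ->
  \sum_(y <- D) cutoff_cost b s x y <= \sum_(y <- nbhd b x) cutoff_cost b s x y.
Proof.
move=> uD; apply: ler_sum_support => //; first exact: nbhd_uniq.
  by move=> y; exact: cutoff_cost_ge0.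
move=> y; rewrite mem_nbhd// => /(nadjacent0 b_ge0)[xy yx].
by rewrite /cutoff_cost xy yx addr0 subr0 normr0 !mul0r addr0.
Qed.

(** On an edge, [2 |a t| <= |a|^2 / b' + b' t^2] with [a] the asymmetry and [t]
    the variation of the cutoff: this is where the weight [1 / b'] in the
    asymmetry bound matches the weight [b'] of chi-completeness. *)
Lemma cutoff_cost_row_le (s : V -> R) (C1 C2 : R) x :
  (m x)^-1 * \sum_(y \in neighbours b x)
    (symmetrized b x y * `|s x - s y| ^+ 2) <= C1 ->
  (m x)^-1 * \sum_(y \in neighbours b x)
    (`|b x y - b y x| ^+ 2 / symmetrized b x y) <= C2 ->
  \sum_(y <- nbhd b x) cutoff_cost b s x y <= m x * (3 / 2 * C1 + C2 / 2).
Proof.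
rewrite !fsbig_nbhd// !ler_pdivrMl// => H1 H2.
apply: (@le_trans _ _ (3 / 2 * \sum_(y <- nbhd b x)
    (symmetrized b x y * `|s x - s y| ^+ 2) +
  2^-1 * \sum_(y <- nbhd b x) (`|b x y - b y x| ^+ 2 / symmetrized b x y)));
  last by lra.
rewrite !mulr_sumr -big_split/= big_seq [leRHS]big_seq.
apply: ler_sum => y; rewrite mem_nbhd// => xy.
have c0 : 0 < symmetrized b x y.
  rewrite /symmetrized divr_gt0//.
  by case/orP: xy => xy; [rewrite ltr_pwDl|rewrite ltr_wpDl].
rewrite /cutoff_cost -/(symmetrized b x y).
rewrite -[(s x - s y) ^+ 2]real_normK ?num_real//.
set c := symmetrized b x y in c0 *; set a := `|b x y - b y x|.
set t := `|s x - s y|.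
have : 0 <= (a - c * t) ^+ 2 / c by rewrite divr_ge0 ?sqr_ge0 ?ltW.
have -> : (a - c * t) ^+ 2 / c = a ^+ 2 / c - 2 * (a * t) + c * t ^+ 2.
  by field; rewrite gt_eqF.
lra.
Qed.

Lemma cutoff_cost_row0 (s : V -> R) x : s x = 1 ->
  (forall y, y \in nbhd b x -> s y = 1) ->
  \sum_(y <- nbhd b x) cutoff_cost b s x y = 0.
Proof.
move=> sx sN; rewrite big_seq big1// => y /sN sy.
by rewrite /cutoff_cost sx sy subrr normr0 expr0n !mulr0 addr0.
Qed.

Lemma exhaustion_seq (B : nat -> set V) (L : seq V) :
  (forall n, B n `<=` B n.+1) -> \bigcup_n B n = [set: V] ->
  exists n, forall x, x \in L -> B n x.
Proof.
move=> Bmono Bcover.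
have Ble n p : (n <= p)%N -> B n `<=` B p.
  move=> /subnK <-; elim: (p - n)%N => //= k IH.
  exact: subset_trans IH (Bmono _).
elim: L => [|x L [n IH]]; first by exists 0%N.
have [k _ Bkx] : (\bigcup_n B n) x by rewrite Bcover.
exists (maxn n k) => y; rewrite inE => /orP[/eqP ->|/IH].
  by apply: (Ble k) => //; exact: leq_maxr.
by apply: Ble; exact: leq_maxl.
Qed.

(** Choose a finite set [F] outside of which [r] has small mass, and a cutoff
    equal to 1 on [F] and on its neighbours: its cost vanishes on the rows
    indexed by [F] and is at most a constant times [m] on the others, so the
    error in [cutoff_estimate] is bounded by the mass of [r] outside [F]. *)
Lemma laplacian_shift_orthogonal0 (z : R[i]) (r : ell2 m) :
  chi_complete b m (symmetrized b) -> bounded_asymmetry b m ->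
  0 < complex.Re z ->
  (forall p, laplacian b m p -> complex.Re (dot (p.2 + z *: p.1) r) = 0) ->
  r = 0.
Proof.
move=> [B [chi [[_ Bmono Bcover] chi_Cc chi1 [C1 C10 HC1]]]] [C2 C20 HC2].
move=> z0 orth.
pose C : R := 3 / 2 * C1 + C2 / 2.
have C0 : 0 < C by rewrite /C; lra.
pose q x := m x * sqn (r x).
have q0 x : 0 <= q x by exact: weight_ge0.
suff qe x (e : R) : 0 < e -> complex.Re z * q x <= C * e.
  apply/val_inj/funext => x; apply/Normc.eq0_normc/eqP.
  rewrite -sqrf_eq0; apply/eqP.
  have [//|mq] := eqVneq (sqn (r x)) 0.
  have sp : 0 < sqn (r x) by rewrite lt0r mq sqr_ge0.
  have qp : 0 < complex.Re z * q x by apply: mulr_gt0 => //; exact: mulr_gt0.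
  have C2p : 0 < 2 * C by rewrite mulr_gt0.
  have := qe x (complex.Re z * q x / (2 * C)) (divr_gt0 qp C2p).
  have -> : C * (complex.Re z * q x / (2 * C)) = complex.Re z * q x / 2.
    by field; rewrite gt_eqF.
  by lra.
move=> e0; have [F FP] := ell2_tail m_gt0 r e0.
pose L := x :: F ++ flatten [seq nbhd b y | y <- F].
have [n BL] := exhaustion_seq L Bmono Bcover.
have [Cs s01] := chi_Cc n.
have s1 y : y \in L -> chi n y = 1 by move=> /BL/chi1.
have Cs' : Cc (fun x => (chi n x)%:C%C : R[i]).
  by apply: sub_finite_set Cs => y /=; apply: contra => /eqP ->.
have [D uD DP] := Cc_absorbs b Cs'.
have sD y : chi n y != 0 -> y \in D /\ {subset nbhd b y <= D}.
  by move=> sy; apply: DP; apply: contra sy => /eqP[->].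
have xD : x \in D.
  by have [] // := sD x; rewrite s1 ?oner_eq0// /L inE eqxx.
have := cutoff_estimate b_ge0 m_gt0 b_lf b_kirchhoff orth Cs s01 uD sD.
have lo : q x <= \sum_(y <- D) m y * (chi n y ^+ 2 * sqn (r y)).
  rewrite (bigD1_seq x)//= s1; last by rewrite /L inE eqxx.
  rewrite expr1n mul1r lerDl.
  apply: sumr_ge0 => y _.
  by apply: mulr_ge0; [exact: ltW|rewrite mulr_ge0 ?sqr_ge0].
have hi : \sum_(y <- D) sqn (r y) * (\sum_(t <- D) cutoff_cost b (chi n) y t) <=
    C * e.
  apply: (@le_trans _ _ (C * \sum_(y <- D | y \notin F) q y)); last first.
    by rewrite ler_pM2l// FP.
  rewrite (bigID (mem F))/= big1_seq ?add0r => [|y /andP[yF _]].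
    rewrite mulr_sumr; apply: ler_sum => y _.
    rewrite /q mulrA mulrC ler_wpM2r ?sqr_ge0// mulrC.
    apply: le_trans (cutoff_cost_row _ _ uD) _.
    by apply: cutoff_cost_row_le; [exact: HC1|exact: HC2].
  apply/eqP; rewrite mulf_eq0; apply/orP; right.
  rewrite eq_le sumr_ge0 ?andbT; last by move=> t _; exact: cutoff_cost_ge0.
  apply: le_trans (cutoff_cost_row _ _ uD) _; rewrite cutoff_cost_row0//.
    by apply: s1; rewrite /L inE mem_cat yF orbT.
  move=> t ty; apply: s1; rewrite /L inE mem_cat; apply/orP; right.
  by apply/orP; right; apply/flatten_mapP; exists y.
have lo' : complex.Re z * q x <=
    complex.Re z * \sum_(y <- D) m y * (chi n y ^+ 2 * sqn (r y)).
  by rewrite ler_pM2l.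
have Ce : 0 < C * e by rewrite mulr_gt0.
lra.
Qed.

End chi_completeness.

Theorem theorem2p2p1 (R : realType) (V : countType)
    (b : V -> V -> R) (m : V -> R)
    (b_ge0 : forall x y, 0 <= b x y)
    (b_diag : forall x, b x x = 0)
    (m_gt0 : forall x, 0 < m x)
    (b_lf : locally_finite b)
    (b_conn : weakly_connected b)
    (b_out : positive_outflow b)
    (b_kirchhoff : kirchhoff b)
    (b_chi : chi_complete b m (symmetrized b))
    (b_asym : bounded_asymmetry b m) :
  m_accretive (ell2_dot m) (op_closure (ell2_dot m) (laplacian b m)).
Proof.
apply: m_accretive_closure.
- exact: ell2_dotP.
- exact: ell2_complete.
- exact: laplacian_accretive.
- move=> f g h /(op_closure_laplacian_formal b_ge0 m_gt0 b_lf) fg.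
  move=> /(op_closure_laplacian_formal b_ge0 m_gt0 b_lf) fh.
  by apply/val_inj; rewrite /= fg fh.
- move=> z r z0 orth.
  exact: (laplacian_shift_orthogonal0 _ _ _ _ _ _ z0 orth).
Qed.
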